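(* Let $\alpha\in(0,1)$ and let $X$ be a random variable with characteristic function $\mathbb{E}e^{itX}=\exp\left(\int_0^\infty(e^{itx}-1)\frac{dx}{x^{\alpha+1}}\right)$, $t\in\mathbb{R}$. Then for every $y\ge(1/\alpha)^{1/\alpha}$, $$\mathbb{P}\Big(X>\frac{1}{1-\alpha}+3y\Big)\le\frac{2}{\alpha y^{\alpha}},$$ and for every $y\ge1$ and $\theta\in(0,1)$, $$\mathbb{P}\Big(X\ge\frac{\theta}{1-\alpha}+y\Big)\ge\frac{2}{3}(1-\theta)^2\frac{1}{1+\alpha y^{\alpha}}.$$
   Context: $X$ is a totally asymmetric strictly $\alpha$-stable random variable; equivalently $X\overset{d}{=}\sum_{i\ge1}(\alpha\tau_i)^{-1/\alpha}$ where $\tau_i=\Gamma_1+\dots+\Gamma_i$ with $(\Gamma_k)$ i.i.d. standard exponential. *)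

(* Defs.v *)
From HB Require Import structures.
From mathcomp Require Import all_boot all_order all_algebra.
From mathcomp Require Import all_classical all_reals all_analysis.
Set Implicit Arguments. Unset Strict Implicit. Unset Printing Implicit Defensive.
Import Order.TTheory GRing.Theory Num.Theory.
Local Open Scope classical_set_scope.
Local Open Scope ring_scope.

(* Real part of the Lévy exponent  int_0^oo (e^{itx}-1) dx/x^{alpha+1} *)
Definition levy_exp_re {R : realType} (alpha t : R) : R :=
  Rintegral (@lebesgue_measure R) `]0%R, +oo[%classic
    (fun x => (cos (t * x) - 1) / x `^ (alpha + 1)).

Definition levy_exp_im {R : realType} (alpha t : R) : R :=
  Rintegral (@lebesgue_measure R) `]0%R, +oo[%classic
    (fun x => sin (t * x) / x `^ (alpha + 1)).

(* X has characteristic function E e^{itX} = exp(levy_exp_re + i levy_exp_im),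
   written via real and imaginary parts:
   E cos(tX) = e^{Re} cos(Im),  E sin(tX) = e^{Re} sin(Im). *)
Definition has_stable_charfun {R : realType} {d} {T : measurableType d}
  (P : probability T R) (X : T -> R) (alpha : R) : Prop :=
  forall t : R,
    (\int[P]_x (cos (t * X x))%:E = (expR (levy_exp_re alpha t) * cos (levy_exp_im alpha t))%:E)%E /\
    (\int[P]_x (sin (t * X x))%:E = (expR (levy_exp_re alpha t) * sin (levy_exp_im alpha t))%:E)%E.

(* Main.v *)
Require Import Defs.
From HB Require Import structures.
From mathcomp Require Import all_boot all_order all_algebra.
From mathcomp Require Import all_classical all_reals all_analysis.
From mathcomp Require Import measurable_realfun ring lra complex.
Set Implicit Arguments. Unset Strict Implicit. Unset Printing Implicit Defensive.
Import Order.TTheory GRing.Theory Num.Theory.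
Import numFieldNormedType.Exports.
Local Open Scope classical_set_scope.
Local Open Scope ring_scope.

(** X is the weak limit of Y_n = S_n + L_n, where S_n and L_n are independent
    and are sums of n i.i.d. copies of the part in ]eps_n, c], respectively in
    ]c, +oo[, of a Pareto variable of density x^(-alpha-1) / n on
    ]eps_n, +oo[.  Indeed the characteristic function of Y_n is
    ((1 + psi_S / n) (1 + psi_L / n))^n with psi_S + psi_L tending to the Levy
    exponent.  The convergence of characteristic functions gives that of the
    expectations of trigonometric polynomials, and a Bernstein polynomial in
    the cosine approximates the indicator of a half-line on [-M, M]; this
    transfers tail bounds from Y_n to X.

    Upper bound: take c = y.  Then Y_n > a forces S_n > a or L_n > 0; the
    first event is controlled by Chebyshev's inequality, as a is at least 2y
    above the mean of S_n, and the second one has probability at most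
    1 / (alpha y^alpha).

    Lower bound: take c = 1.  By independence the probability is at least
    P(S_n >= theta / (1 - alpha)) P(L_n >= y); the first factor is bounded by
    the Paley-Zygmund inequality and the second one is at least
    1 - (1 - q)^n with n q = 1 / (alpha y^alpha). *)

(** * Trigonometric approximation of step functions *)

(** The small and large parts of one Pareto jump exclude each other, so they are dependent. Drawing
    them from independent copies replaces the one-step characteristic function 1 + (psi_S + psi_L) /
    n by (1 + psi_S / n) (1 + psi_L / n). This changes it by O(1 / n^2), hence its n-th power by O(1
    / n), and the tail bounds become bounds on a product space.

    A polynomial in one cosine is periodic, so it looks like a step only on [-M, M], and the mass
    outside needs separate control. For the upper bound, Y_n >= 0 and 0 <= f <= 1 suffice. The lower
    bound needs tightness of Y_n. As alpha < 1, large jumps have infinite mean, so Markov's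
    inequality is applied to min(1, Y_n / M): this function is subadditive, and its expectation is
    O(M^(-alpha)) uniformly in n.

    Constants: Chebyshev yields at most 1 / ((2 - alpha) y^alpha) <= 1 / (alpha y^alpha), the same
    bound as for L_n, whence the factor 2. The factor 2/3 is the inverse of 3/2, where E S_n^2 <=
    (3/2) / (1 - alpha)^2 because 2 (1 - alpha)^2 <= 2 - alpha. *)

Section bernstein.
Context {R : realType}.
Implicit Types (g : nat -> R) (u c : R).

(* The expectation of [g (j + B)] for a binomial variable [B] of parameters
   [n] and [u]. *)
Fixpoint bernstein (n : nat) g (j : nat) u : R :=
  if n is m.+1 then u * bernstein m g j.+1 u + (1 - u) * bernstein m g j u
  else g j.

Lemma le_bernstein n g h j u : 0 <= u <= 1 -> (forall k, g k <= h k) ->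
  bernstein n g j u <= bernstein n h j u.
Proof.
move=> /andP[u0 u1] gh; elim: n j => [|n IH] j //=.
by rewrite lerD// ler_wpM2l// subr_ge0.
Qed.

Lemma bernstein_cst n c j u : bernstein n (fun=> c) j u = c.
Proof. by elim: n j => [|n IH] j //=; rewrite !IH; ring. Qed.

Lemma bernsteinZ n g c j u :
  bernstein n (fun k => c * g k) j u = c * bernstein n g j u.
Proof. by elim: n j => [|n IH] j //=; rewrite !IH; ring. Qed.

Lemma bernsteinB1 n g j u :
  bernstein n (fun k => 1 - g k) j u = 1 - bernstein n g j u.
Proof. by elim: n j => [|n IH] j //=; rewrite !IH; ring. Qed.

(** Variance of the binomial plus the squared distance of the mean [j + n u] to [c]. The recursion
    moves [j], so the induction needs it general. *)
Lemma bernstein_sqr n c j u : bernstein n (fun k => (k%:R - c) ^+ 2) j u =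
  n%:R * (u * (1 - u)) + (j%:R + n%:R * u - c) ^+ 2.
Proof.
elim: n j => [|n IH] j /=; first by ring.
by rewrite !IH -!natr1; ring.
Qed.

(** Chebyshev's inequality for the binomial law: [g] lies below the parabola
    [(k - n u)^2 / (n d)^2], and the variance factor [u (1 - u)] is at most 1. *)
Lemma bernstein_tail n g u (d : R) : (0 < n)%N -> 0 <= u <= 1 -> 0 < d ->
  (forall k, g k <= 1) -> (forall k, `|k%:R - n%:R * u| < n%:R * d -> g k <= 0) ->
  bernstein n g 0 u <= (n%:R * d ^+ 2)^-1.
Proof.
move=> n0 u01 d0 g1 g0.
have nR : 0 < n%:R :> R by rewrite ltr0n.
have nd : 0 < n%:R * d by rewrite mulr_gt0.
apply: (@le_trans _ _ (bernstein n (fun k => (n%:R * d) ^- 2 *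
    (k%:R - n%:R * u) ^+ 2) 0 u)).
  apply: le_bernstein => // k.
  have [lt|ge] := ltP `|k%:R - n%:R * u| (n%:R * d).
    by rewrite (le_trans (g0 _ lt))// mulr_ge0// ?invr_ge0 ?sqr_ge0// exprn_ge0// ltW.
  rewrite (le_trans (g1 k))// mulrC ler_pdivlMr ?exprn_gt0// mul1r.
  by rewrite -[leRHS]real_normK ?num_real// ler_pXn2r// nnegrE// ltW.
rewrite bernsteinZ bernstein_sqr add0r subrr expr0n addr0.
have -> : (n%:R * d) ^- 2 * (n%:R * (u * (1 - u))) =
    u * (1 - u) * (n%:R * d ^+ 2)^-1 by field; rewrite !lt0r_neq0.
rewrite ler_piMl ?invr_ge0 ?mulr_ge0 ?exprn_ge0 ?(ltW d0)//.
by move/andP: u01 => [? ?]; rewrite mulr_ile1// ?subr_ge0//; lra.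
Qed.

End bernstein.

(** The phase [s] brings in the sines as well. Limits of expectations are later obtained by
    induction on these three rules. *)
Inductive trigpoly {R : realType} : (R -> R) -> Prop :=
| trigpoly_cos t s : trigpoly (fun x => cos (t * x + s))
| trigpolyD f g : trigpoly f -> trigpoly g -> trigpoly (fun x => f x + g x)
| trigpolyZ c f : trigpoly f -> trigpoly (fun x => c * f x).

Section trigpoly.
Context {R : realType}.
Implicit Types (f g : R -> R).

Lemma trigpoly_cst (c : R) : trigpoly (fun=> c).
Proof.
have -> : (fun=> c) = (fun x => c * cos (0 * x + 0)).
  by apply/funext => x; rewrite mul0r addr0 cos0 mulr1.
exact/trigpolyZ/trigpoly_cos.
Qed.

(** On generators this is the product-to-sum formula; bilinearity does the rest. *)
Lemma trigpolyM f g : trigpoly f -> trigpoly g ->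
  trigpoly (fun x => f x * g x).
Proof.
move=> + tg; elim: tg f => [t s|g1 g2 _ IH1 _ IH2|c g1 _ IH] f tf.
- elim: tf => [t' s'|f1 f2 _ IH1 _ IH2|c f1 _ IH].
  + have -> : (fun x : R => cos (t' * x + s') * cos (t * x + s)) =
        (fun x => 2^-1 * (cos ((t' + t) * x + (s' + s)) +
                          cos ((t' - t) * x + (s' - s)))).
      apply/funext => x.
      have -> : (t' + t) * x + (s' + s) = (t' * x + s') + (t * x + s) by ring.
      have -> : (t' - t) * x + (s' - s) = (t' * x + s') - (t * x + s) by ring.
      move: (t' * x + s') (t * x + s) => p q.
      by rewrite cosD cosB; field.
    by apply: trigpolyZ; apply: trigpolyD; exact: trigpoly_cos.
  + by under eq_fun do rewrite mulrDl; exact: trigpolyD.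
  + by under eq_fun do rewrite -mulrA; exact: trigpolyZ.
- by under eq_fun do rewrite mulrDr; apply: trigpolyD; [exact: IH1|exact: IH2].
- by under eq_fun do rewrite mulrCA; apply: trigpolyZ; exact: IH.
Qed.

Lemma trigpoly_bernstein n (h : nat -> R) j f : trigpoly f ->
  trigpoly (fun x => bernstein n h j (f x)).
Proof.
move=> tf; elim: n j => [|n IH] j /=; first exact: trigpoly_cst.
apply: trigpolyD; apply: trigpolyM => //.
apply: trigpolyD; first exact: trigpoly_cst.
under eq_fun do rewrite -mulN1r; exact: trigpolyZ.
Qed.

Lemma trigpoly_continuous f : trigpoly f -> continuous f.
Proof.
elim=> [t s|f1 f2 _ IH1 _ IH2|c f1 _ IH] x.
- apply: continuous_comp; last exact: continuous_cos.
  by apply: cvgD; [exact: cvgMr|exact: cvg_cst].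
- exact: cvgD (IH1 x) (IH2 x).
- exact: cvgMr (IH x).
Qed.

(** Bernstein's proof of Weierstrass' theorem: [u] rises from 0 to 1 on [[-M, M]], and a binomial
    variable of parameters [n] and [u x], divided by [n], falls on the same side of the midpoint [w]
    of [u a] and [u b] as [u x], up to probability [1 / (n d^2)]. *)
Lemma trigpoly_step (a b M e : R) : - M < a -> a < b -> b < M -> 0 < e ->
  exists f, [/\ trigpoly f, (forall x, 0 <= f x <= 1),
    (forall x, - M <= x <= a -> f x <= e) &
    (forall x, b <= x <= M -> 1 - e <= f x)].
Proof.
move=> Ma ab bM e0.
have M0 : 0 < M by lra.
have pi0 : 0 < pi :> R := pi_gt0 R.
(* [v] maps [[-M, M]] affinely onto [[0, pi]], where the cosine decreases. *)
pose v (x : R) : R := pi / (2 * M) * x + pi / 2.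
(* This is [(1 - cos (v x)) / 2]; the phase absorbs the sign, so that [u] is built by the rules of
   [trigpoly]. *)
pose u (x : R) : R := 2^-1 * (1 + cos (v x + pi)).
have uE x : u x = 2^-1 * (1 - cos (v x)) by rewrite /u cosDpi.
have tu : trigpoly u.
  apply: trigpolyZ; apply: trigpolyD; first exact: trigpoly_cst.
  under eq_fun do rewrite /v -addrA.
  exact: trigpoly_cos.
have u01 x : 0 <= u x <= 1.
  by rewrite uE; have := cos_geN1 (v x); have := cos_le1 (v x); lra.
have vI x : - M <= x <= M -> v x \in `[0, pi].
  move=> /andP[h1 h2]; rewrite in_itv/= /v.
  have -> : pi / (2 * M) * x + pi / 2 = pi / (2 * M) * (x + M).
    by field; rewrite lt0r_neq0.
  rewrite mulr_ge0/= ?divr_ge0//; [|lra..].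
  rewrite -subr_ge0 (_ : _ - _ = pi / (2 * M) * (M - x)).
    by rewrite mulr_ge0 ?divr_ge0//; lra.
  by field; rewrite lt0r_neq0.
have lev x y : x <= y -> v x <= v y.
  by move=> xy; rewrite lerD2r ler_wpM2l// divr_ge0//; lra.
have leu x y : - M <= x -> x <= y -> y <= M -> u x <= u y.
  move=> Mx xy yM; rewrite !uE ler_pM2l// lerD2l lerN2.
  have vx : v x \in `[0, pi] by apply: vI; lra.
  have vy : v y \in `[0, pi] by apply: vI; lra.
  by rewrite leNgt (ltr_cos vy vx) -leNgt; exact: lev.
have ltu : u a < u b.
  have va : v a \in `[0, pi] by apply: vI; lra.
  have vb : v b \in `[0, pi] by apply: vI; lra.
  rewrite !uE ltr_pM2l// ltrD2l ltrN2 (ltr_cos va vb).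
  by rewrite ltrD2r ltr_pM2l// divr_gt0//; lra.
pose w := (u a + u b) / 2; pose d := (u b - u a) / 2.
have d0 : 0 < d by rewrite /d; lra.
have ed : 0 < e * d ^+ 2 by rewrite mulr_gt0// exprn_gt0.
(* The degree is chosen so that Chebyshev's bound [1 / (n d^2)] is at most [e]. *)
have edn : (e * d ^+ 2)^-1 < (Num.bound (e * d ^+ 2)^-1)%:R.
  by apply: archi_boundP; rewrite invr_ge0 ltW.
move: edn; set n := Num.bound _ => edn.
have nR : 0 < n%:R :> R by rewrite (lt_trans _ edn)// invr_gt0.
have n0 : (0 < n)%N by rewrite -(ltr0n R).
have ned : (n%:R * d ^+ 2)^-1 <= e.
  move: edn; rewrite -[X in X < _]div1r ltr_pdivrMr// => h.
  rewrite -[leLHS]div1r ler_pdivrMr; last by rewrite mulr_gt0// exprn_gt0.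
  lra.
pose g (k : nat) : R := if n%:R * w <= k%:R then 1 else 0.
exists (fun x => bernstein n g 0 (u x)); split.
- exact: trigpoly_bernstein.
- move=> x; apply/andP; split.
  + rewrite -[leLHS](bernstein_cst n 0 0 (u x)); apply: le_bernstein => // k.
    by rewrite /g; case: ifP.
  + rewrite -[leRHS](bernstein_cst n 1 0 (u x)); apply: le_bernstein => // k.
    by rewrite /g; case: ifP.
- move=> x /andP[Mx xa]; apply: le_trans ned; apply: bernstein_tail => //.
    by move=> k; rewrite /g; case: ifP.
  move=> k; rewrite ltr_norml => /andP[_ h]; rewrite /g ifF//.
  apply/negbTE; rewrite -ltNge; apply: (@lt_le_trans _ _ (n%:R * (u x + d))).
    by rewrite mulrDr; lra.
  by rewrite ler_pM2l// /d /w; have := leu x a Mx xa (ltW (lt_trans ab bM)); lra.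
- move=> x /andP[bx xM].
  suff : bernstein n (fun k => 1 - g k) 0 (u x) <= e by rewrite bernsteinB1; lra.
  apply: le_trans ned; apply: bernstein_tail => //.
    by move=> k; rewrite /g; case: ifP; lra.
  move=> k; rewrite ltr_norml => /andP[h _]; rewrite /g ifT ?subrr//.
  apply: (@le_trans _ _ (n%:R * (u x - d))); last by rewrite mulrBr; lra.
  rewrite ler_pM2l// /d /w.
  by have := leu b x (ltW (lt_trans Ma ab)) bx xM; lra.
Qed.

End trigpoly.

(** * Complex exponentials *)

(** Telescoping: in the unit disc, exchanging one of the [n] factors costs at most [|x - y|]. *)
Lemma ler_normXB (K : numDomainType) (x y : K) n : `|x| <= 1 -> `|y| <= 1 ->
  `|x ^+ n - y ^+ n| <= n%:R * `|x - y|.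
Proof.
move=> x1 y1; elim: n => [|n IH]; first by rewrite !expr0 subrr normr0 mul0r.
have -> : x ^+ n.+1 - y ^+ n.+1 = x ^+ n * (x - y) + (x ^+ n - y ^+ n) * y.
  by rewrite !exprSr; ring.
rewrite (le_trans (ler_normD _ _))// addrC.
have -> : n.+1%:R * `|x - y| = n%:R * `|x - y| + `|x - y|.
  by rewrite -natr1; ring.
rewrite lerD//.
  by rewrite normrM (le_trans _ IH)// ler_piMr.
by rewrite normrM ler_piMl// normrX exprn_ile1.
Qed.

Section complex_exp.
Context {R : realType}.
Implicit Types a b : R.

Lemma norm_sin_le b : `|sin b| <= `|b|.
Proof.
wlog b0 : b / 0 <= b => [H|].
  have [/H//|/ltW b0] := leP 0 b.
  by rewrite -normrN -sinN -(normrN b) H// oppr_ge0.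
rewrite ler_norml (ger0_norm b0).
have [->|bn0] := eqVneq b 0; first by rewrite sin0 oppr0 lexx.
have bp : 0 < b by rewrite lt_neqAle eq_sym bn0.
have [c _] := @MVT R (@sin R) (@cos R) 0 b bp
  (fun x _ => is_derive_sin x) (continuous_subspaceT (@continuous_sin R)).
rewrite sin0 !subr0 => ->.
have := cos_geN1 c; have := cos_le1 c => h1 h2.
by apply/andP; split; nra.
Qed.

(** Both follow from [1 - cos b = 2 sin(b/2)^2]. The linear bound makes the Levy integrand
    integrable at 0, the quadratic one enters the Taylor remainder. *)
Lemma cos_bounds b : 0 <= 1 - cos b <= `|b| /\ 1 - cos b <= b ^+ 2.
Proof.
pose s := sin (b / 2).
have e : 1 - cos b = 2 * s ^+ 2.
  rewrite (_ : cos b = cos (b / 2 *+ 2)); last by rewrite -mulr_natr divfK.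
  rewrite cos_mulr2n /s sin2cos2; ring.
have s1 : `|s| <= 1 := sin_max _.
have sb : `|s| <= `|b| / 2.
  have := norm_sin_le (b / 2).
  by rewrite normrM [`|2^-1|]gtr0_norm.
have s0 : 0 <= `|s| by [].
have s2 : s ^+ 2 = `|s| ^+ 2 by rewrite real_normK ?num_real.
have b2 : b ^+ 2 = `|b| ^+ 2 by rewrite real_normK ?num_real.
rewrite e s2 b2; split; [apply/andP; split|]; nra.
Qed.

Lemma sinB_le b : `|sin b - b| <= b ^+ 2.
Proof.
wlog b0 : b / 0 <= b => [H|].
  have [/H//|/ltW b0] := leP 0 b.
  have := H (- b); rewrite oppr_ge0 => /(_ b0).
  by rewrite sinN -opprD normrN sqrrN.
have [->|bn0] := eqVneq b 0; first by rewrite sin0 subrr normr0 expr0n.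
have bp : 0 < b by rewrite lt_neqAle eq_sym bn0.
have [c /[!in_itv]/= /andP[c0 cb]] := @MVT R (@sin R) (@cos R) 0 b bp
  (fun x _ => is_derive_sin x) (continuous_subspaceT (@continuous_sin R)).
rewrite sin0 !subr0 => ->.
have [/andP[h1 h2] _] := cos_bounds c.
rewrite (gtr0_norm c0) in h2.
have -> : cos c * b - b = - ((1 - cos c) * b) by ring.
rewrite normrN normrM (ger0_norm h1) (ger0_norm b0).
by rewrite expr2 ler_wpM2r//; lra.
Qed.

Lemma expR_bounds a : a <= 0 -> 0 <= expR a - 1 - a <= a ^+ 2.
Proof.
move=> a0; have := expR_ge1Dx a; have := expR_ge1Dx (- a).
have ea : 0 < expR a by exact: expR_gt0.
have := expRxMexpNx_1 a; have := expR_gt0 (- a).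
move: (expR a) (expR (- a)) ea => p q p0 q0 pq h1 h2.
apply/andP; split; first lra.
(* So [e^a <= 1 / (1 - a)], which exceeds [1 + a] by [a^2 / (1 - a) <= a^2]. *)
have : p * (1 - a) <= 1 by rewrite -[leRHS]pq ler_pM2l.
nra.
Qed.

(** First-order expansion of the complex exponential at 0 in the left half-plane, where
    [expR a <= 1] keeps the remainder quadratic. *)
Lemma cexp_re a b : a <= 0 ->
  `|expR a * cos b - 1 - a| <= a ^+ 2 + b ^+ 2.
Proof.
move=> a0; have /andP[h1 h2] := expR_bounds a0.
have [/andP[h3 _] h4] := cos_bounds b.
have ea := expR_gt0 a; have ea1 : expR a <= 1 by rewrite expR_le1.
have b2 := sqr_ge0 b; have a2 := sqr_ge0 a.
by rewrite ler_norml; apply/andP; split; nra.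
Qed.

Lemma cexp_im a b : a <= 0 ->
  `|expR a * sin b - b| <= (`|a| + `|b|) ^+ 2.
Proof.
move=> a0; have /andP[h1 h2] := expR_bounds a0.
have ea := expR_gt0 a; have ea1 : expR a <= 1 by rewrite expR_le1.
have -> : expR a * sin b - b = expR a * (sin b - b) + (expR a - 1) * b by ring.
rewrite (le_trans (ler_normD _ _))// !normrM.
have hs := sinB_le b.
have -> : `|expR a| = expR a by rewrite gtr0_norm.
have h5 : `|expR a - 1| <= `|a|.
  by rewrite ler0_norm ?ler0_norm//; lra.
have b0 : 0 <= `|b| by []. have a00 : 0 <= `|a| by [].
have b2 : b ^+ 2 = `|b| ^+ 2 by rewrite real_normK ?num_real.
rewrite b2 in hs.
have := normr_ge0 (sin b - b); have := normr_ge0 (expR a - 1).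
move: (`|sin b - b|) (`|expR a - 1|) (expR a) `|a| `|b| ea ea1 hs h5 b0 a00.
move=> u v p x y *; nra.
Qed.

Local Open Scope complex_scope.

(** The exponential of [a + i b], in coordinates so as to match [has_stable_charfun]. *)
Definition cexp a b : R[i] := (expR a * cos b) +i* (expR a * sin b).

Lemma cexp_le1 a b : a <= 0 -> `|cexp a b| <= 1.
Proof.
move=> a0; rewrite normc_def (_ : 1 = 1%:C)// lecR -sqrtr1 ler_sqrt//=.
by rewrite !exprMn -mulrDr cos2Dsin2 mulr1 exprn_ile1// ?expR_le1// ltW// expR_gt0.
Qed.

Lemma cexpX a b n : cexp a b ^+ n = cexp (n%:R * a) (n%:R * b).
Proof.
elim: n => [|n IH]; first by rewrite /cexp !mul0r expR0 cos0 sin0 expr0 !mul1r.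
rewrite exprSr IH /cexp; simpc; rewrite -natr1 !mulrDl !mul1r expRD cosD sinD.
by congr (_ +i* _); ring.
Qed.

Lemma complex_norm_le (x : R[i]) : `|x| <= (`|complex.Re x| + `|complex.Im x|)%:C.
Proof.
rewrite normc_def lecR.
rewrite -[leRHS]ger0_norm ?addr_ge0// -sqrtr_sqr ler_sqrt ?sqr_ge0//.
rewrite sqrrD !real_normK ?num_real//.
by rewrite addrAC lerDl mulrn_wge0// mulr_ge0.
Qed.

Lemma re_im_norm_le (x : R[i]) (e : R) : `|x| <= e%:C ->
  `|complex.Re x| <= e /\ `|complex.Im x| <= e.
Proof.
rewrite normc_def lecR => h.
by split; rewrite (le_trans _ h)// -sqrtr_sqr ler_sqrt ?lerDl ?lerDr
  ?addr_ge0 ?sqr_ge0.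
Qed.

(* [z1 z2] agrees with [exp ((p + i q) / n)] up to [2 e / n + O(1 / n^2)], and
   taking n-th powers in the unit disc costs a factor [n]. *)
Lemma charfun_powers_close (n : nat) (ps qs pl ql p q K e : R) (z1 z2 : R[i]) :
  (0 < n)%N -> p <= 0 -> `|z1| <= 1 -> `|z2| <= 1 ->
  z1 = (1 + ps / n%:R) +i* (qs / n%:R) ->
  z2 = (1 + pl / n%:R) +i* (ql / n%:R) ->
  `|ps| <= K -> `|qs| <= K -> `|pl| <= K -> `|ql| <= K -> `|p| <= K ->
  `|q| <= K -> `|ps + pl - p| <= e -> `|qs + ql - q| <= e ->
  `|z1 ^+ n * z2 ^+ n - cexp p q| <= (2 * e + 10 * K ^+ 2 / n%:R)%:C.
Proof.
move=> n0 p0 z11 z21 e1 e2 Kps Kqs Kpl Kql Kp Kq he1 he2.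
have nR : 0 < n%:R :> R by rewrite ltr0n.
pose m : R := n%:R^-1.
have m0 : 0 < m by rewrite invr_gt0.
have nm : n%:R * m = 1 by rewrite mulfV// gt_eqF.
have K0 : 0 <= K by rewrite (le_trans _ Kp).
pose w := cexp (p / n%:R) (q / n%:R).
have wn : cexp p q = w ^+ n.
  by rewrite cexpX !(mulrC n%:R) !divfK// gt_eqF.
have pm0 : p / n%:R <= 0 by rewrite pmulr_lle0// invr_gt0.
rewrite -exprMn wn.
have zz1 : `|z1 * z2| <= 1 by rewrite normrM mulr_ile1.
have ww1 : `|w| <= 1 by exact: cexp_le1.
apply: (le_trans (ler_normXB n zz1 ww1)).
have -> : (n%:R : R[i]) = (n%:R : R)%:C by rewrite rmorph_nat.
set x := _ - w.
apply: (@le_trans _ _ (n%:R%:C * (`|complex.Re x| + `|complex.Im x|)%:C)).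
  by rewrite ler_wpM2l ?ler0c ?ler0n// complex_norm_le.
rewrite -rmorphM/= lecR.
have hre := cexp_re (q / n%:R) pm0; have him := cexp_im (q / n%:R) pm0.
(* The terms of order [1 / n] cancel up to [e / n]; what remains, the cross products and the Taylor
   remainder of [w], is of order [1 / n^2]. *)
have xre : complex.Re x = (ps + pl - p) * m + (ps * pl - qs * ql) * m ^+ 2 -
    (expR (p / n%:R) * cos (q / n%:R) - 1 - p / n%:R).
  by rewrite /x e1 e2 /w /cexp; simpc => /=; rewrite -/m; ring.
have xim : complex.Im x = (qs + ql - q) * m + (ps * ql + qs * pl) * m ^+ 2 -
    (expR (p / n%:R) * sin (q / n%:R) - q / n%:R).
  by rewrite /x e1 e2 /w /cexp; simpc => /=; rewrite -/m; ring.
have M (a b : R) : `|a| <= K -> `|b| <= K -> `|a * b| <= K ^+ 2.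
  by move=> ? ?; rewrite normrM expr2 ler_pM.
have hre' : `|expR (p / n%:R) * cos (q / n%:R) - 1 - p / n%:R| <= 2 * K ^+ 2 * m ^+ 2.
  apply: (le_trans hre); rewrite -/m !exprMn -mulrDl ler_wpM2r ?sqr_ge0//.
  have := M _ _ Kp Kp; have := M _ _ Kq Kq.
  by rewrite -!expr2 !ger0_norm ?sqr_ge0//; lra.
have him' : `|expR (p / n%:R) * sin (q / n%:R) - q / n%:R| <= 4 * K ^+ 2 * m ^+ 2.
  apply: (le_trans him); rewrite -/m !normrM (gtr0_norm m0) -mulrDl exprMn.
  rewrite ler_wpM2r ?sqr_ge0//.
  have -> : 4 * K ^+ 2 = (2 * K) ^+ 2 by ring.
  by rewrite ler_pXn2r// ?nnegrE ?addr_ge0//; lra.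
(* The coefficient of [K ^+ 2] is 2 + 2 for the real part and 2 + 4 for the imaginary part: hence
   the 10 of the statement. *)
have b1 : `|complex.Re x| <= e * m + 4 * K ^+ 2 * m ^+ 2.
  rewrite xre (le_trans (ler_normB _ _))//.
  have -> : e * m + 4 * K ^+ 2 * m ^+ 2 =
     e * m + 2 * K ^+ 2 * m ^+ 2 + 2 * K ^+ 2 * m ^+ 2 by ring.
  rewrite lerD// (le_trans (ler_normD _ _))// lerD//.
    by rewrite normrM (gtr0_norm m0) ler_pM2r.
  rewrite normrM (ger0_norm (sqr_ge0 m)) ler_wpM2r ?sqr_ge0//.
  rewrite (le_trans (ler_normB _ _))//.
  have := M _ _ Kps Kpl; have := M _ _ Kqs Kql; lra.
have b2 : `|complex.Im x| <= e * m + 6 * K ^+ 2 * m ^+ 2.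
  rewrite xim (le_trans (ler_normB _ _))//.
  have -> : e * m + 6 * K ^+ 2 * m ^+ 2 =
     e * m + 2 * K ^+ 2 * m ^+ 2 + 4 * K ^+ 2 * m ^+ 2 by ring.
  rewrite lerD// (le_trans (ler_normD _ _))// lerD//.
    by rewrite normrM (gtr0_norm m0) ler_pM2r.
  rewrite normrM (ger0_norm (sqr_ge0 m)) ler_wpM2r ?sqr_ge0//.
  rewrite (le_trans (ler_normD _ _))//.
  have := M _ _ Kps Kql; have := M _ _ Kqs Kpl; lra.
apply: (@le_trans _ _ (n%:R * (2 * e * m + 10 * K ^+ 2 * m ^+ 2))).
  by rewrite ler_pM2l//; lra.
rewrite mulrDr -/m.
have -> : n%:R * (2 * e * m) = 2 * e * (n%:R * m) by ring.
have -> : n%:R * (10 * K ^+ 2 * m ^+ 2) = 10 * K ^+ 2 * m * (n%:R * m) by ring.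
by rewrite nm !mulr1.
Qed.

End complex_exp.

(** * Characteristic functions and sums of independent variables *)

Section bounded_integral.
Context {R : realType} {d : measure_display} {T : measurableType d}.
Variable P : probability T R.
Implicit Types f g : T -> R.

Lemma bounded_integrable f (M : R) : measurable_fun setT f ->
  (forall x, `|f x| <= M) -> P.-integrable setT (EFin \o f).
Proof.
move=> mf fM; apply: measurable_bounded_integrable => //.
  exact: (le_lt_trans (probability_le1 P measurableT) (ltry _)).
exists M; split; first exact: num_real.
by move=> x Mx y _; exact: le_trans (fM y) (ltW Mx).
Qed.

Lemma Rintegral_prob_cst (c : R) : \int[P]_x c = c.
Proof. by rewrite Rintegral_cst//; have /= -> := probability_setT P; rewrite mulr1. Qed.

End bounded_integral.

Section product.
Context {R : realType} {d1 d2 : measure_display}.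
Context {T1 : measurableType d1} {T2 : measurableType d2}.
Variables (P1 : probability T1 R) (P2 : probability T2 R).

Lemma integral_prodM_ge0 (f : T1 -> R) (g : T2 -> R) :
  measurable_fun setT f -> measurable_fun setT g ->
  (forall x, 0 <= f x) -> (forall x, 0 <= g x) ->
  (\int[P1 \x P2]_z (f z.1 * g z.2)%:E =
   (\int[P1]_x (f x)%:E) * \int[P2]_x (g x)%:E)%E.
Proof.
move=> mf mg f0 g0.
rewrite fubini_tonelli1 /fubini_F/=; last 2 first.
- apply/measurable_EFinP; apply: measurable_funM;
    exact: measurableT_comp.
- by move=> z; rewrite lee_fin mulr_ge0.
under eq_integral => x _.
  under eq_integral do rewrite EFinM.
  rewrite ge0_integralZl_EFin//; last 2 first.
    - by move=> y _; rewrite lee_fin.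
    - exact/measurable_EFinP.
  over.
rewrite ge0_integralZr//.
- exact/measurable_EFinP.
- by move=> x _; rewrite lee_fin.
- by apply: integral_ge0 => x _; rewrite lee_fin.
Qed.

Lemma integral_prod1_ge0 (f : T1 -> R) : measurable_fun setT f ->
  (forall x, 0 <= f x) ->
  (\int[P1 \x P2]_z (f z.1)%:E = \int[P1]_x (f x)%:E)%E.
Proof.
move=> mf f0.
have m1 : measurable_fun setT (fun _ : T2 => 1 : R) by exact: measurable_cst.
have := integral_prodM_ge0 mf m1 f0.
under eq_integral do rewrite /= mulr1.
by move=> ->//; rewrite integral_cst//= probability_setT !mule1.
Qed.

Lemma integral_prod2_ge0 (f : T2 -> R) : measurable_fun setT f ->
  (forall x, 0 <= f x) ->
  (\int[P1 \x P2]_z (f z.2)%:E = \int[P2]_x (f x)%:E)%E.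
Proof.
move=> mf f0.
have m1 : measurable_fun setT (fun _ : T1 => 1 : R) by exact: measurable_cst.
have := fun h => integral_prodM_ge0 m1 mf h f0.
under eq_integral do rewrite /= mul1r.
by move=> ->//; rewrite integral_cst//= probability_setT !mul1e.
Qed.

(** Sines and cosines change sign, so Fubini is needed in place of Tonelli; the bounds supply
    integrability. *)
Lemma Rintegral_prodM (f : T1 -> R) (g : T2 -> R) (M N : R) :
  measurable_fun setT f -> measurable_fun setT g ->
  (forall x, `|f x| <= M) -> (forall x, `|g x| <= N) ->
  \int[(P1 \x P2)%E]_z (f z.1 * g z.2) =
   (\int[P1]_x f x) * \int[P2]_x g x.
Proof.
move=> mf mg fM gN.
have mfg : measurable_fun setT (fun z : T1 * T2 => f z.1 * g z.2).
  by apply: measurable_funM; exact: measurableT_comp.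
have ifg : (P1 \x P2)%E.-integrable setT
    (EFin \o (fun z : T1 * T2 => f z.1 * g z.2)).
  apply: (@bounded_integrable _ _ _ _ _ (M * N)) => //= z.
  by rewrite normrM ler_pM.
have ig := bounded_integrable P2 mg gN.
have iF := bounded_integrable P1 mf fM.
rewrite {1}/Rintegral -integral12_prod_meas1//= -[X in _ * X]/(fine _).
rewrite -RintegralZr//.
congr fine; apply: eq_integral => x _ /=.
rewrite /fubini_F/=; under eq_integral do rewrite EFinM.
rewrite integralZl// [RHS]EFinM; congr *%E.
by rewrite /Rintegral fineK//; exact: integrable_fin_num.
Qed.

End product.
Arguments Rintegral_prodM {R d1 d2 T1 T2 P1 P2 f g} M N.

Section charfun.
Context {R : realType}.
Local Open Scope complex_scope.

Definition charfun {d} {T : measurableType d} (P : probability T R)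
    (Y : T -> R) (t : R) : R[i] :=
  (\int[P]_x cos (t * Y x)) +i* (\int[P]_x sin (t * Y x)).

Section charfun_bounds.
Context {d : measure_display} {T : measurableType d}.
Variables (P : probability T R) (Y : T -> R).
Hypothesis mY : measurable_fun setT Y.

Lemma measurable_cosM t : measurable_fun setT (fun x => cos (t * Y x)).
Proof.
apply: (@measurableT_comp _ _ _ _ _ _ (@cos R)).
  exact: (continuous_measurable_fun (@continuous_cos R)).
exact: measurable_funM.
Qed.

Lemma measurable_sinM t : measurable_fun setT (fun x => sin (t * Y x)).
Proof.
apply: (@measurableT_comp _ _ _ _ _ _ (@sin R)).
  exact: (continuous_measurable_fun (@continuous_sin R)).
exact: measurable_funM.
Qed.

Lemma integrable_cosM t : P.-integrable setT (EFin \o (fun x => cos (t * Y x))).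
Proof.
apply: bounded_integrable; first exact: measurable_cosM.
by move=> x; exact: cos_max.
Qed.

Lemma integrable_sinM t : P.-integrable setT (EFin \o (fun x => sin (t * Y x))).
Proof.
apply: bounded_integrable; first exact: measurable_sinM.
by move=> x; exact: sin_max.
Qed.

Lemma integrable_lin_cos_sin t (a b : R) : P.-integrable setT
  (EFin \o (fun x => a * cos (t * Y x) + b * sin (t * Y x))).
Proof.
apply: (@bounded_integrable _ _ _ _ _ (`|a| + `|b|)) => [|x].
  by apply: measurable_funD; apply: measurable_funM => //;
    [exact: measurable_cosM|exact: measurable_sinM].
rewrite (le_trans (ler_normD _ _))// !normrM.
by rewrite lerD// ler_piMr// ?cos_max ?sin_max.
Qed.

Lemma Rintegral_lin_cos_sin t (a b : R) :
  \int[P]_x (a * cos (t * Y x) + b * sin (t * Y x)) =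
  a * complex.Re (charfun P Y t) + b * complex.Im (charfun P Y t).
Proof.
rewrite RintegralD//=.
- by rewrite !RintegralZl//; [exact: integrable_sinM|exact: integrable_cosM].
- have := integrable_lin_cos_sin t a 0.
  by under eq_fun do rewrite mul0r addr0.
- have := integrable_lin_cos_sin t 0 b.
  by under eq_fun do rewrite mul0r add0r.
Qed.

(** With [c + i s] the value of the characteristic function, [c^2 + s^2] is the mean of
    [c cos + s sin], which is pointwise at most [(c^2 + s^2 + 1) / 2]. *)
Lemma charfun_le1 t : `|charfun P Y t| <= 1.
Proof.
rewrite normc_def (_ : 1 = 1%:C)// lecR -sqrtr1 ler_sqrt//.
set c := complex.Re _; set s := complex.Im _.
have : \int[P]_x (c * cos (t * Y x) + s * sin (t * Y x)) <=
    \int[P]_x ((c ^+ 2 + s ^+ 2 + 1) / 2).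
  apply: le_Rintegral => //.
  - exact: integrable_lin_cos_sin.
  - by apply: bounded_integrable => // x; exact: lexx.
  move=> x _; have := cos2Dsin2 (t * Y x).
  have := sqr_ge0 (c - cos (t * Y x)); have := sqr_ge0 (s - sin (t * Y x)).
  by lra.
rewrite Rintegral_prob_cst Rintegral_lin_cos_sin -/c -/s; lra.
Qed.

End charfun_bounds.

Lemma charfunD {d1 d2} {T1 : measurableType d1} {T2 : measurableType d2}
    (P1 : probability T1 R) (P2 : probability T2 R) (A : T1 -> R) (B : T2 -> R) t :
  measurable_fun setT A -> measurable_fun setT B ->
  charfun (P1 \x P2)%E (fun z => A z.1 + B z.2) t =
  charfun P1 A t * charfun P2 B t.
Proof.
move=> mA mB.
have mcA := measurable_cosM mA t; have msA := measurable_sinM mA t.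
have mcB := measurable_cosM mB t; have msB := measurable_sinM mB t.
have M2 (f : T1 -> R) (g : T2 -> R) : measurable_fun setT f ->
    measurable_fun setT g -> (forall x, `|f x| <= 1) -> (forall x, `|g x| <= 1) ->
    (P1 \x P2)%E.-integrable setT (EFin \o (fun z => f z.1 * g z.2)) /\
    \int[(P1 \x P2)%E]_z (f z.1 * g z.2) = (\int[P1]_x f x) * \int[P2]_x g x.
  move=> mf mg f1 g1; split; last exact: (Rintegral_prodM 1 1).
  apply: (@bounded_integrable _ _ _ _ _ 1) => [|z].
    by apply: measurable_funM; exact: measurableT_comp.
  by rewrite normrM mulr_ile1.
have [icc ecc] := M2 _ _ mcA mcB (fun=> cos_max _) (fun=> cos_max _).
have [iss ess] := M2 _ _ msA msB (fun=> sin_max _) (fun=> sin_max _).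
have [isc esc] := M2 _ _ msA mcB (fun=> sin_max _) (fun=> cos_max _).
have [ics ecs] := M2 _ _ mcA msB (fun=> cos_max _) (fun=> sin_max _).
rewrite /charfun; simpc; congr (_ +i* _).
- under eq_Rintegral do rewrite mulrDr cosD.
  by rewrite RintegralB// ecc ess.
- under eq_Rintegral do rewrite mulrDr sinD.
  by rewrite RintegralD// esc ecs addrC.
Qed.

End charfun.

(** * Sums of n independent copies of a nonnegative variable *)

Section iid_sum.
Context {R : realType}.

(** One notion for two uses: the capped identity, which gives tightness, and the indicator of the
    positive reals, which gives the union bound. *)
Definition subadditive_ge0 (h : R -> R) := [/\ measurable_fun setT h,
  (forall x, 0 <= h x), h 0 = 0 &
  (forall x y, 0 <= x -> 0 <= y -> h (x + y) <= h x + h y)].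

Lemma measurable_prod_add {d1 d2} {T1 : measurableType d1} {T2 : measurableType d2}
    (A : T1 -> R) (B : T2 -> R) :
  measurable_fun setT A -> measurable_fun setT B ->
  measurable_fun setT (fun z : T1 * T2 => A z.1 + B z.2).
Proof. by move=> mA mB; apply: measurable_funD; exact: measurableT_comp. Qed.

Lemma integral_prod_subadditive {d1 d2} {T1 : measurableType d1}
    {T2 : measurableType d2} (P1 : probability T1 R) (P2 : probability T2 R)
    (A : T1 -> R) (B : T2 -> R) h :
  measurable_fun setT A -> measurable_fun setT B ->
  (forall x, 0 <= A x) -> (forall x, 0 <= B x) -> subadditive_ge0 h ->
  (\int[P1 \x P2]_z (h (A z.1 + B z.2))%:E <=
   \int[P1]_x (h (A x))%:E + \int[P2]_x (h (B x))%:E)%E.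
Proof.
move=> mA mB A0 B0 [mh h0 _ hD].
have mhA : measurable_fun setT (fun x => h (A x)) by exact: measurableT_comp.
have mhB : measurable_fun setT (fun x => h (B x)) by exact: measurableT_comp.
rewrite -(integral_prod1_ge0 P1 P2 mhA)// -(integral_prod2_ge0 P1 P2 mhB)//.
have h1 : measurable_fun setT (fun z : T1 * T2 => (h (A z.1))%:E).
  by apply/measurable_EFinP; apply: (measurableT_comp mhA).
have h2 : measurable_fun setT (fun z : T1 * T2 => (h (B z.2))%:E).
  by apply/measurable_EFinP; apply: (measurableT_comp mhB).
rewrite -ge0_integralD//=; last 2 first.
- by move=> z _; rewrite lee_fin.
- by move=> z _; rewrite lee_fin.
apply: ge0_le_integral => //=.
- by move=> z _; rewrite lee_fin.
- apply/measurable_EFinP; apply: (measurableT_comp mh).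
  exact: measurable_prod_add.
- exact: emeasurable_funD.
- by move=> z _; rewrite -EFinD lee_fin hD.
Qed.

Lemma integral_prod_add {d1 d2} {T1 : measurableType d1}
    {T2 : measurableType d2} (P1 : probability T1 R) (P2 : probability T2 R)
    (A : T1 -> R) (B : T2 -> R) :
  measurable_fun setT A -> measurable_fun setT B ->
  (forall x, 0 <= A x) -> (forall x, 0 <= B x) ->
  (\int[P1 \x P2]_z (A z.1 + B z.2)%:E =
   \int[P1]_x (A x)%:E + \int[P2]_x (B x)%:E)%E.
Proof.
move=> mA mB A0 B0.
under eq_integral do rewrite EFinD.
rewrite ge0_integralD//=.
- by rewrite (integral_prod1_ge0 P1 P2 mA)// (integral_prod2_ge0 P1 P2 mB).
- by move=> z _; rewrite lee_fin.
- by apply/measurable_EFinP; exact: measurableT_comp.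
- by move=> z _; rewrite lee_fin.
- by apply/measurable_EFinP; exact: measurableT_comp.
Qed.

Lemma integral_prod_add_sqr {d1 d2} {T1 : measurableType d1}
    {T2 : measurableType d2} (P1 : probability T1 R) (P2 : probability T2 R)
    (A : T1 -> R) (B : T2 -> R) :
  measurable_fun setT A -> measurable_fun setT B ->
  (forall x, 0 <= A x) -> (forall x, 0 <= B x) ->
  (\int[P1 \x P2]_z ((A z.1 + B z.2) ^+ 2)%:E =
   \int[P1]_x (A x ^+ 2)%:E + \int[P2]_x (B x ^+ 2)%:E +
   2%:E * ((\int[P1]_x (A x)%:E) * \int[P2]_x (B x)%:E))%E.
Proof.
move=> mA mB A0 B0.
have mA2 : measurable_fun setT (fun x => A x ^+ 2) by exact: measurable_funX.
have mB2 : measurable_fun setT (fun x => B x ^+ 2) by exact: measurable_funX.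
have h1 : measurable_fun setT (fun z : T1 * T2 => (A z.1 ^+ 2)%:E).
  by apply/measurable_EFinP; apply: (measurableT_comp mA2).
have h2 : measurable_fun setT (fun z : T1 * T2 => (B z.2 ^+ 2)%:E).
  by apply/measurable_EFinP; apply: (measurableT_comp mB2).
have h3 : measurable_fun setT (fun z : T1 * T2 => (A z.1 * B z.2)%:E).
  by apply/measurable_EFinP; apply: measurable_funM; exact: measurableT_comp.
have -> : (fun z : T1 * T2 => ((A z.1 + B z.2) ^+ 2)%:E) =
    (fun z => (A z.1 ^+ 2)%:E + (B z.2 ^+ 2)%:E + 2%:E * (A z.1 * B z.2)%:E)%E.
  by apply/funext => z; rewrite -EFinM -!EFinD; congr EFin; ring.
rewrite ge0_integralD//=; last 4 first.
- by move=> z _; rewrite -EFinD lee_fin addr_ge0// sqr_ge0.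
- exact: emeasurable_funD.
- by move=> z _; rewrite lee_fin !mulr_ge0.
- exact: measurable_funeM.
rewrite ge0_integralD//=; last 2 first.
- by move=> z _; rewrite lee_fin sqr_ge0.
- by move=> z _; rewrite lee_fin sqr_ge0.
rewrite ge0_integralZl_EFin//=; last by move=> z _; rewrite lee_fin mulr_ge0.
rewrite (integral_prodM_ge0 P1 P2 mA mB)//.
rewrite (integral_prod1_ge0 P1 P2 mA2) => [|x]; last exact: sqr_ge0.
by rewrite (integral_prod2_ge0 P1 P2 mB2) => [//|x]; exact: sqr_ge0.
Qed.

Lemma measurable_lt_set {d} {T : measurableType d} (A : T -> R) (y : R) :
  measurable_fun setT A -> measurable [set w | A w < y].
Proof.
move=> mA; have := mA measurableT `]-oo, y[%classic (measurable_itv _).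
by rewrite setTI; congr measurable; apply/seteqP; split => x /=; rewrite in_itv.
Qed.

Lemma measurable_gt_set {d} {T : measurableType d} (A : T -> R) (y : R) :
  measurable_fun setT A -> measurable [set w | y < A w].
Proof.
move=> mA; have := mA measurableT `]y, +oo[%classic (measurable_itv _).
rewrite setTI; congr measurable; apply/seteqP; split => x /=;
by rewrite in_itv/= andbT.
Qed.

Lemma measurable_ge_set {d} {T : measurableType d} (A : T -> R) (y : R) :
  measurable_fun setT A -> measurable [set w | y <= A w].
Proof.
move=> mA; have := mA measurableT `[y, +oo[%classic (measurable_itv _).
rewrite setTI; congr measurable; apply/seteqP; split => x /=;
by rewrite in_itv/= andbT.
Qed.

(** The space is an iterated product, so it changes with [n] and is quantified existentially,
    together with all that is used later about the sum. The moment clause is conditional because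
    large jumps have infinite mean. *)
Lemma iid_sum {d0} {T0 : measurableType d0} (P0 : probability T0 R)
    (xi : T0 -> R) n : measurable_fun setT xi -> (forall x, 0 <= xi x) ->
  exists d (T : measurableType d) (P : probability T R) (S : T -> R),
  [/\ measurable_fun setT S /\ (forall x, 0 <= S x),
      (forall t, charfun P S t = charfun P0 xi t ^+ n),
      (forall m1 m2, (\int[P0]_x (xi x)%:E = m1%:E)%E ->
        (\int[P0]_x (xi x ^+ 2)%:E = m2%:E)%E ->
        (\int[P]_x (S x)%:E = (n%:R * m1)%:E)%E /\
        (\int[P]_x (S x ^+ 2)%:E =
          (n%:R * m2 + n%:R * (n%:R - 1) * m1 ^+ 2)%:E)%E),
      (forall h m, subadditive_ge0 h -> (\int[P0]_x (h (xi x))%:E <= m%:E)%E ->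
        (\int[P]_x (h (S x))%:E <= (n%:R * m)%:E)%E) &
      (forall y q, (P0 [set w | (xi w < y)%R] <= q%:E)%E ->
        (P [set w | (S w < y)%R] <= (q ^+ n)%:E)%E)].
Proof.
move=> mxi xi0; elim: n => [|n [d [T [P [S [[mS S0] chS mom sub tail]]]]]].
  exists d0, T0, P0, (fun=> 0); split.
  - by split.
  - move=> t; rewrite expr0 /charfun mulr0 cos0 sin0 Rintegral_prob_cst.
    by rewrite Rintegral_prob_cst.
  - move=> m1 m2 _ _; rewrite !mul0r addr0 expr0n/=.
    by rewrite integral0.
  - by move=> h m [_ _ h0 _] _; rewrite mul0r h0 integral0.
  - by move=> y q _; rewrite expr0 probability_le1//; exact: measurable_lt_set.
exists _, _, (P \x P0)%E, (fun z => S z.1 + xi z.2); split.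
- split; first exact: measurable_prod_add.
  by move=> z; rewrite addr_ge0.
- by move=> t; rewrite charfunD// chS exprSr.
- move=> m1 m2 e1 e2; have [E1 E2] := mom _ _ e1 e2; split.
    rewrite (integral_prod_add P P0 mS mxi)// E1 e1 -EFinD; congr EFin.
    by rewrite -natr1; ring.
  rewrite (integral_prod_add_sqr P P0 mS mxi)// E1 E2 e1 e2 -!EFinM -!EFinD.
  by congr EFin; rewrite -natr1; ring.
- move=> h m hh hm.
  apply: (le_trans (integral_prod_subadditive P P0 mS mxi S0 xi0 hh)).
  by rewrite -natr1 mulrDl mul1r EFinD leeD// sub.
- move=> y q hq; have mSy := measurable_lt_set y mS.
  have mxy := measurable_lt_set y mxi.
  (* The terms are nonnegative: a sum below [y] forces both of them below [y]. *)
  apply: (@le_trans _ _ ((P \x P0)%E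
      ([set w | S w < y] `*` [set w | xi w < y]))).
    apply: le_measure; rewrite ?inE.
    - by apply: measurable_lt_set; exact: measurable_prod_add.
    - exact: measurableX.
    - move=> z /= h; have := S0 z.1; have := xi0 z.2; lra.
  rewrite product_measure1E// exprSr EFinM.
  by apply: lee_pmul => //; exact: tail.
Qed.

End iid_sum.

(** * Integrals against the Levy measure *)

Section power_integrals.
Context {R : realType}.
Notation mu := (@lebesgue_measure R).
Implicit Types a b p x : R.

Lemma continuous_powR_pos p x : 0 < x -> {for x, continuous (fun y : R => y `^ p)}.
Proof.
move=> x0; apply/differentiable_continuous/derivable1_diffP.
by apply: derivable_powR; rewrite in_itv/= x0.
Qed.

Lemma is_derive_powR_div p x : 0 < x -> p != 0 ->
  is_derive x 1 (fun y : R => p^-1 * y `^ p) (x `^ (p - 1)).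
Proof.
move=> x0 p0.
have h := is_deriveZ p^-1 (is_derive1_powR p x0).
apply: is_derive_eq h _.
by rewrite scalerA mulVf// scale1r.
Qed.

Lemma integral_powR a b p : 0 < a -> a < b -> p != 0 ->
  (\int[mu]_(x in `]a, b]) (x `^ (p - 1))%:E = (p^-1 * (b `^ p - a `^ p))%:E)%E.
Proof.
move=> a0 ab p0.
rewrite integral_itv_obnd_cbnd; last first.
  by apply/measurable_EFinP; apply: measurable_funTS; exact: measurable_powR.
rewrite (@continuous_FTC2 _ _ (fun x => p^-1 * x `^ p))//.
- by rewrite -EFinB mulrBr.
- apply: continuous_in_subspaceT => x; rewrite inE/= in_itv/= => /andP[ax _].
  by apply: continuous_powR_pos; exact: lt_le_trans ax.
- have h x : 0 < x -> {for x, continuous (fun x : R => p^-1 * x `^ p)}.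
    by move=> x0; apply: cvgMr; exact: continuous_powR_pos.
  split.
  + move=> x /[!in_itv]/= /andP[ax _].
    by have [] := is_derive_powR_div (lt_trans a0 ax) p0.
  + by apply: cvg_at_right_filter; exact: h.
  + by apply: cvg_at_left_filter; apply: h; exact: lt_trans ab.
- move=> x /[!in_itv]/= /andP[ax _].
  have [_ dx] := is_derive_powR_div (lt_trans a0 ax) p0.
  by rewrite derive1E.
Qed.

Lemma powR_small p e x : p < 0 -> 0 < e -> e `^ p^-1 <= x -> x `^ p <= e.
Proof.
move=> p0 e0; have q0 : 0 < e `^ p^-1 by exact: powR_gt0.
have -> : (x `^ p <= e) = (x `^ p <= (e `^ p^-1) `^ p).
  by rewrite -powRrM mulVf ?lt_eqF// powRr1// ltW.
move: (e `^ p^-1) q0 => q q0 qx; have x0 := lt_le_trans q0 qx.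
rewrite -[p]opprK !(powRN _ (- p)) lef_pV2 ?posrE ?powR_gt0//.
by apply: ge0_ler_powR => //; rewrite ?nnegrE ?oppr_ge0 ltW.
Qed.

Lemma cvg_powR_pinfty p : p < 0 -> (fun x : R => x `^ p) @ +oo --> (0 : R).
Proof.
move=> p0; apply/cvgrPdist_le => e e0; near=> x.
rewrite /= sub0r normrN ger0_norm; last exact: powR_ge0.
apply: powR_small => //.
Unshelve. all: by end_near. Qed.

Lemma integral_powRy a p : 0 < a -> p < 0 ->
  (\int[mu]_(x in `]a, +oo[) (x `^ (p - 1))%:E = ((- p)^-1 * a `^ p)%:E)%E.
Proof.
move=> a0 p0; have pn0 : p != 0 by rewrite lt_eqF.
rewrite integral_itv_obnd_cbnd; last first.
  by apply/measurable_EFinP; apply: measurable_funTS; exact: measurable_powR.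
have h x : 0 < x -> {for x, continuous (fun x : R => p^-1 * x `^ p)}.
  by move=> x0; apply: cvgMr; exact: continuous_powR_pos.
rewrite (@ge0_continuous_FTC2y _ _ (fun x => p^-1 * x `^ p) _ 0)//.
- by rewrite -EFinB sub0r invrN mulNr.
- by move=> x _; exact: powR_ge0.
- apply: continuous_in_subspaceT => x; rewrite inE/= in_itv/= andbT => ax.
  by apply: continuous_powR_pos; exact: lt_le_trans ax.
- rewrite -(mulr0 p^-1); apply: cvgMr; exact: cvg_powR_pinfty.
- move=> x ax.
  by have [] := is_derive_powR_div (lt_trans a0 ax) pn0.
- by apply: cvg_at_right_filter; exact: h.
- move=> x /[!in_itv]/= /andP[ax _].
  have [_ dx] := is_derive_powR_div (lt_trans a0 ax) pn0.
  by rewrite derive1E.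
Qed.

(** The integrand may blow up at 0, so the interval is exhausted by the [F n] and monotone
    convergence applies. The shift [n.+2] keeps the left end strictly below [b] even for [n = 0]. *)
Lemma integral_powR0_le b p : 0 < b -> 0 < p ->
  (\int[mu]_(x in `]0%R, b]) (x `^ (p - 1))%:E <= (p^-1 * b `^ p)%:E)%E.
Proof.
move=> b0 p0; pose F (n : nat) := `](b / n.+2%:R), b]%classic : set R.
have -> : `]0%R, b]%classic = \bigcup_n F n.
  apply/seteqP; split => x /=; rewrite /F.
    rewrite in_itv/= => /andP[x0 xb].
    have := archi_boundP (ltW (divr_gt0 b0 x0)).
    set N := Num.bound _ => hN; exists N => //=; rewrite in_itv/= xb andbT.
    rewrite ltr_pdivrMr ?ltr0n// mulrC -ltr_pdivrMr//.
    by rewrite (lt_le_trans hN)// ler_nat -addn2 leq_addr.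
  move=> [n _] /=; rewrite !in_itv/= => /andP[h ->]; rewrite andbT.
  by rewrite (lt_trans _ h)// divr_gt0// ltr0n.
have mp D : measurable_fun D (fun x : R => (x `^ (p - 1))%:E).
  by apply/measurable_EFinP; apply: measurable_funTS; exact: measurable_powR.
have cv : (\int[mu]_(x in F n) (x `^ (p - 1))%:E @[n --> \oo] -->
    \int[mu]_(x in \bigcup_n F n) (x `^ (p - 1))%:E)%E.
  apply: ge0_nondecreasing_set_cvg_integral.
  - move=> m n mn; apply/subsetPset => x; rewrite /F/= !in_itv/=.
    move=> /andP[h ->]; rewrite andbT (le_lt_trans _ h)//.
    by rewrite ler_pM2l// lef_pV2 ?posrE ?ltr0n// ler_nat.
  - by move=> n; exact: measurable_itv.
  - by move=> n; exact: mp.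
  - by move=> n x _; rewrite lee_fin powR_ge0.
apply: (cvge_le _ cv); near=> n.
rewrite integral_powR ?divr_gt0 ?ltr0n// ?gt_eqF//.
  by rewrite lee_fin ler_wpM2l ?invr_ge0 ?(ltW p0)// gerBl powR_ge0.
by rewrite ltr_pdivrMr ?ltr0n// ltr_pMr// ltr1n.
Unshelve. all: by end_near. Qed.

End power_integrals.

(** * Probability measures given by a density *)

Section density.
Context {R : realType}.
Notation mu := (@lebesgue_measure R).
Variable g : R -> R.
Hypotheses (mg : measurable_fun setT g) (g0 : forall x, 0 <= g x).
Hypothesis g1 : (\int[mu]_x (g x)%:E = 1)%E.

(** The proofs are arguments so that the measure and probability structures can be declared on this
    constant. *)
Definition density_prob of measurable_fun setT g & (forall x, 0 <= g x) &
  (\int[mu]_x (g x)%:E = 1)%E :=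
  fun V : set (measurableTypeR R) => (\int[mu]_(x in V) (g x)%:E)%E.

Local Notation Q := (density_prob mg g0 g1).

Let Q0 : Q set0 = 0%E.
Proof. by rewrite /density_prob integral_set0. Qed.

Let Q_ge0 V : (0 <= Q V)%E.
Proof. by apply: integral_ge0 => x _; rewrite lee_fin. Qed.

Let Q_sigma_additive : semi_sigma_additive Q.
Proof.
move=> F mF tF mUF; rewrite /density_prob; apply: cvg_toP.
  apply: ereal_nondecreasing_is_cvgn => m n mn.
  apply: lee_sum_nneg_natr => // k _ _.
  by apply: integral_ge0 => x _; rewrite lee_fin.
rewrite ge0_integral_bigcup//=.
- by apply/measurable_EFinP; exact: measurable_funTS.
- by move=> x _; rewrite lee_fin.
Qed.

HB.instance Definition _ := isMeasure.Build _ _ _ Q Q0 Q_ge0 Q_sigma_additive.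

Let QT : Q setT = 1%E.
Proof. by []. Qed.

HB.instance Definition _ := Measure_isProbability.Build _ _ _ Q QT.

Lemma density_prob_dom : Q `<< mu.
Proof.
apply/null_content_dominatesP => A mA muA0.
by apply: null_set_integral => //; apply/measurable_EFinP; exact: measurable_funTS.
Qed.

(** The Radon-Nikodym derivative of [Q] has the same integral as [g] over every measurable set, so
    it equals [g] almost everywhere. *)
Lemma integral_density_prob f : Q.-integrable setT f ->
  (\int[Q]_x f x = \int[mu]_x (f x * (g x)%:E))%E.
Proof.
move=> intf; have mf := measurable_int _ intf.
have mgE : measurable_fun setT (fun x => (g x)%:E) by exact/measurable_EFinP.
rewrite -(Radon_Nikodym_change_of_variables density_prob_dom)//=.
apply: ae_eq_integral => //.
- apply: emeasurable_funM => //; apply: (measurable_int mu).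
  by apply: Radon_Nikodym_integrable; exact: density_prob_dom.
- exact: emeasurable_funM.
- apply: ae_eqe_mul2l => /=.
  apply: integral_ae_eq => //=.
  + by apply: Radon_Nikodym_integrable; exact: density_prob_dom.
  + move=> E _ mE; rewrite -Radon_Nikodym_integral//=.
    exact: density_prob_dom.
Qed.

Lemma Rintegral_density_prob (f : R -> R) (M : R) : measurable_fun setT f ->
  (forall x, `|f x| <= M) -> \int[Q]_x f x = \int[mu]_x (f x * g x).
Proof.
move=> mf fM; congr fine; apply: integral_density_prob.
exact: (@bounded_integrable _ _ _ Q _ M).
Qed.

End density.

(** * Integrands dominated by a multiple of min(x, 1) *)

Section levy_integral.
Context {R : realType}.
Notation mu := (@lebesgue_measure R).
Variable alpha : R.
Hypothesis alpha01 : 0 < alpha < 1.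

Let a0 : 0 < alpha. Proof. by case/andP: alpha01. Qed.
Let a1 : alpha < 1. Proof. by case/andP: alpha01. Qed.

Lemma levy_weight0 x : (x `^ (alpha + 1))^-1 = x `^ (- alpha - 1).
Proof. by rewrite -powRN opprD. Qed.

Lemma levy_weight1 x : 0 < x -> x / x `^ (alpha + 1) = x `^ ((1 - alpha) - 1).
Proof.
move=> x0; rewrite levy_weight0 -{1}(powRr1 (ltW x0)) -powRD.
  by congr (_ `^ _); ring.
by rewrite (gt_eqF x0) implybT.
Qed.

Lemma levy_weight2 x : 0 < x ->
  x ^+ 2 / x `^ (alpha + 1) = x `^ ((2 - alpha) - 1).
Proof.
move=> x0; rewrite levy_weight0 -(powR_mulrn 2 (ltW x0)) -powRD.
  by congr (_ `^ _); ring.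
by rewrite (gt_eqF x0) implybT.
Qed.

Lemma measurable_levy (phi : R -> R) D : measurable_fun setT phi ->
  measurable_fun D (fun x => phi x / x `^ (alpha + 1)).
Proof.
move=> mphi; apply: measurable_funTS.
under eq_fun do rewrite levy_weight0.
by apply: measurable_funM => //; exact: measurable_powR.
Qed.

Lemma levy_tail b : 0 < b ->
  (\int[mu]_(x in `]b, +oo[) (1 / x `^ (alpha + 1))%:E =
   (alpha^-1 * b `^ (- alpha))%:E)%E.
Proof.
move=> b0; under eq_integral do rewrite div1r levy_weight0.
by rewrite integral_powRy ?oppr_lt0// opprK.
Qed.

Section dominated.
Variables (phi : R -> R) (C1 C2 : R).
Hypothesis mphi : measurable_fun setT phi.
Hypothesis C10 : 0 <= C1.
Hypothesis C20 : 0 <= C2.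
Hypothesis phi1 : forall x, 0 < x -> `|phi x| <= C1 * x.
Hypothesis phi2 : forall x, 0 < x -> `|phi x| <= C2.

Let f x := phi x / x `^ (alpha + 1).

Let mf D : measurable_fun D f.
Proof. exact: measurable_levy. Qed.

Let mnf D : measurable_fun D (fun x => `|(f x)%:E|%E).
Proof.
by apply/measurable_EFinP; apply: (@measurableT_comp _ _ _ _ _ _ (@Num.norm R R)).
Qed.

Let normf x : `|f x| = `|phi x| / x `^ (alpha + 1).
Proof. by rewrite /f normrM normfV (ger0_norm (powR_ge0 _ _)). Qed.

(** The bound [C1 * x] leaves [x^(-alpha)], integrable at 0 because [alpha < 1]. *)
Lemma levy_small_le b : 0 < b ->
  (\int[mu]_(x in `]0%R, b]) `|(f x)%:E| <=
   (C1 * ((1 - alpha)^-1 * b `^ (1 - alpha)))%:E)%E.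
Proof.
move=> b0.
apply: (@le_trans _ _ (\int[mu]_(x in `]0%R, b])
    (C1%:E * (x `^ ((1 - alpha) - 1))%:E))%E).
  apply: ge0_le_integral => //=.
  - exact: mnf.
  - apply: measurable_funeM; apply/measurable_EFinP; apply: measurable_funTS.
    exact: measurable_powR.
  - move=> x /[!in_itv]/= /andP[x0 _]; rewrite -EFinM lee_fin normf.
    rewrite -levy_weight1// mulrA ler_wpM2r ?invr_ge0 ?powR_ge0//.
    exact: phi1.
rewrite ge0_integralZl_EFin//=; last 2 first.
- by move=> x _; rewrite lee_fin powR_ge0.
- by apply/measurable_EFinP; apply: measurable_funTS; exact: measurable_powR.
by rewrite EFinM lee_wpmul2l ?lee_fin// integral_powR0_le// subr_gt0.
Qed.

(** The bound [C2] leaves [x^(-alpha-1)], integrable at infinity because [alpha > 0]. *)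
Lemma levy_large_le b : 0 < b ->
  (\int[mu]_(x in `]b, +oo[) `|(f x)%:E| <=
   (C2 * (alpha^-1 * b `^ (- alpha)))%:E)%E.
Proof.
move=> b0.
apply: (@le_trans _ _ (\int[mu]_(x in `]b, +oo[)
    (C2%:E * (1 / x `^ (alpha + 1))%:E))%E).
  apply: ge0_le_integral => //=.
  - exact: mnf.
  - apply: measurable_funeM; apply/measurable_EFinP.
    exact: (@measurable_levy (fun=> 1)).
  - move=> x /[!in_itv]/= /andP[bx _]; rewrite -EFinM lee_fin normf div1r.
    rewrite ler_wpM2r ?invr_ge0 ?powR_ge0//.
    by apply: phi2; exact: lt_trans bx.
rewrite ge0_integralZl_EFin//=; last 2 first.
- by move=> x _; rewrite lee_fin div1r invr_ge0 powR_ge0.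
- by apply/measurable_EFinP; exact: (@measurable_levy (fun=> 1)).
by rewrite levy_tail.
Qed.

(** The cut [b] stays free: 1 will do for integrability and for the trigonometric bounds, while the
    tightness estimate takes it equal to the level [M]. *)
Lemma levy_norm_le b : 0 < b ->
  (\int[mu]_(x in `]0%R, +oo[) `|(f x)%:E| <=
   (C1 * ((1 - alpha)^-1 * b `^ (1 - alpha)) +
    C2 * (alpha^-1 * b `^ (- alpha)))%:E)%E.
Proof.
move=> b0.
have -> : `]0%R, +oo[%classic = `]0%R, b] `|` `]b, +oo[ :> set R.
  by rewrite -itv_bndbnd_setU// bnd_simp ltW.
rewrite ge0_integral_setU//=.
- by rewrite EFinD leeD//; [exact: levy_small_le|exact: levy_large_le].
- exact: mnf.
- apply/disj_setPLR => x /=; rewrite !in_itv/= => /andP[_ x1].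
  by rewrite andbT => /(le_lt_trans x1); rewrite ltxx.
Qed.

Lemma levy_integrable : mu.-integrable `]0%R, +oo[ (EFin \o f).
Proof.
apply/integrableP; split.
  by apply/measurable_EFinP; exact: mf.
exact: le_lt_trans (levy_norm_le ltr01) (ltry _).
Qed.

Lemma levy_integrableS (A : set R) : measurable A -> A `<=` `]0%R, +oo[ ->
  mu.-integrable A (EFin \o f).
Proof. by move=> mA sA; apply: integrableS levy_integrable. Qed.

Lemma levy_Rintegral_le (A : set R) b : measurable A -> A `<=` `]0%R, +oo[ ->
  0 < b -> `|\int[mu]_(x in A) f x| <=
   C1 * ((1 - alpha)^-1 * b `^ (1 - alpha)) + C2 * (alpha^-1 * b `^ (- alpha)).
Proof.
move=> mA sA b0; rewrite -lee_fin EFin_normr_Rintegral//; last exact: levy_integrableS.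
apply: le_trans (levy_norm_le b0); apply: le_trans (le_abse_integral _ _ _) _ => //.
  by apply/measurable_EFinP; exact: mf.
apply: ge0_subset_integral => //=.
exact: mnf.
Qed.

Lemma levy_Rintegral_small_le b : 0 < b ->
  `|\int[mu]_(x in `]0%R, b]) f x| <= C1 * ((1 - alpha)^-1 * b `^ (1 - alpha)).
Proof.
move=> b0; have sA : `]0%R, b]%classic `<=` `]0%R, +oo[.
  by move=> x /=; rewrite !in_itv/= => /andP[->].
rewrite -lee_fin EFin_normr_Rintegral//; last exact: levy_integrableS.
apply: le_trans (levy_small_le b0).
apply: le_abse_integral => //.
by apply/measurable_EFinP; exact: mf.
Qed.

Lemma levy_Rintegral_split e c : 0 < e -> e < c ->
  \int[mu]_(x in `]0%R, +oo[) f x = \int[mu]_(x in `]0%R, e]) f x +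
   (\int[mu]_(x in `]e, c]) f x + \int[mu]_(x in `]c, +oo[) f x).
Proof.
move=> e0 ec.
have := @Rintegral_itvB R f (BRight 0) (BInfty R false) e levy_integrable.
rewrite !bnd_simp (ltW e0) => /(_ isT isT).
have i2 : mu.-integrable `]e, +oo[ (EFin \o f).
  apply: levy_integrableS => //.
  by move=> x /=; rewrite !in_itv/= !andbT; exact: lt_trans.
have := @Rintegral_itvB R f (BRight e) (BInfty R false) c i2.
rewrite !bnd_simp (ltW ec) => /(_ isT isT).
by move=> <- <-; ring.
Qed.

End dominated.
End levy_integral.

(** * The truncated Levy exponent *)

Section levy_trig.
Context {R : realType}.
Notation mu := (@lebesgue_measure R).
Variables (alpha t : R).
Hypothesis alpha01 : 0 < alpha < 1.

Let a0 : 0 < alpha. Proof. by case/andP: alpha01. Qed.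
Let a1 : alpha < 1. Proof. by case/andP: alpha01. Qed.

Let mcos : measurable_fun setT (fun x : R => cos (t * x) - 1).
Proof.
apply: measurable_funB => //.
by apply: (@measurable_cosM R _ _ id); exact: measurable_id.
Qed.

Let msin : measurable_fun setT (fun x : R => sin (t * x)).
Proof. by apply: (@measurable_sinM R _ _ id); exact: measurable_id. Qed.

(** Plays both [C1] and [C2]: [|t|] accounts for the slope at 0, and 2 bounds [|cos - 1|]. *)
Let C := `|t| + 2.
Let C0 : 0 <= C. Proof. by rewrite addr_ge0. Qed.

Let cos1 x : 0 < x -> `|cos (t * x) - 1| <= C * x.
Proof.
move=> x0; have [/andP[h1 h2] _] := cos_bounds (t * x).
rewrite distrC ger0_norm// (le_trans h2)// normrM (gtr0_norm x0).
by rewrite ler_wpM2r ?(ltW x0)// lerDl.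
Qed.

Let cos2 x : 0 < x -> `|cos (t * x) - 1| <= C.
Proof.
move=> x0; have := cos_le1 (t * x); have := cos_geN1 (t * x) => h1 h2.
have t0 := normr_ge0 t.
by rewrite ler_norml /C; apply/andP; split; lra.
Qed.

Let sin1 x : 0 < x -> `|sin (t * x)| <= C * x.
Proof.
move=> x0; rewrite (le_trans (norm_sin_le _))// normrM (gtr0_norm x0).
by rewrite ler_wpM2r ?(ltW x0)// lerDl.
Qed.

Let sin2 x : 0 < x -> `|sin (t * x)| <= C.
Proof.
by move=> x0; rewrite (le_trans (sin_max _))// /C; have := normr_ge0 t; lra.
Qed.

Lemma levy_trig_integrable (A : set R) : measurable A -> A `<=` `]0%R, +oo[ ->
  mu.-integrable A (EFin \o (fun x => (cos (t * x) - 1) / x `^ (alpha + 1))) /\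
  mu.-integrable A (EFin \o (fun x => sin (t * x) / x `^ (alpha + 1))).
Proof.
by move=> mA sA; split;
  [exact: (levy_integrableS alpha01 mcos C0 C0 cos1 cos2)
  |exact: (levy_integrableS alpha01 msin C0 C0 sin1 sin2)].
Qed.

Lemma levy_trig_le (A : set R) : measurable A -> A `<=` `]0%R, +oo[ ->
  `|\int[mu]_(x in A) ((cos (t * x) - 1) / x `^ (alpha + 1))| <=
    C * ((1 - alpha)^-1 + alpha^-1) /\
  `|\int[mu]_(x in A) (sin (t * x) / x `^ (alpha + 1))| <=
    C * ((1 - alpha)^-1 + alpha^-1).
Proof.
move=> mA sA.
have h := levy_Rintegral_le alpha01 mcos C0 C0 cos1 cos2 mA sA ltr01.
have k := levy_Rintegral_le alpha01 msin C0 C0 sin1 sin2 mA sA ltr01.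
by rewrite !powR1 !mulr1 -mulrDr in h k.
Qed.

(** Cutting the jumps below [e] costs the integral over []0, e]], which vanishes with [e]. *)
Lemma levy_trig_split e c : 0 < e -> e < c ->
  `|\int[mu]_(x in `]e, c]) ((cos (t * x) - 1) / x `^ (alpha + 1)) +
    \int[mu]_(x in `]c, +oo[) ((cos (t * x) - 1) / x `^ (alpha + 1)) -
    levy_exp_re alpha t| <= C * ((1 - alpha)^-1 * e `^ (1 - alpha)) /\
  `|\int[mu]_(x in `]e, c]) (sin (t * x) / x `^ (alpha + 1)) +
    \int[mu]_(x in `]c, +oo[) (sin (t * x) / x `^ (alpha + 1)) -
    levy_exp_im alpha t| <= C * ((1 - alpha)^-1 * e `^ (1 - alpha)).
Proof.
move=> e0 ec; rewrite /levy_exp_re /levy_exp_im.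
rewrite (levy_Rintegral_split alpha01 mcos C0 C0 cos1 cos2 e0 ec).
rewrite (levy_Rintegral_split alpha01 msin C0 C0 sin1 sin2 e0 ec).
have h := levy_Rintegral_small_le alpha01 mcos C0 C0 cos1 cos2 e0.
have k := levy_Rintegral_small_le alpha01 msin C0 C0 sin1 sin2 e0.
have E (x y : R) : y - (x + y) = - x by ring.
by rewrite !E !normrN.
Qed.

Lemma levy_exp_le : `|levy_exp_re alpha t| <= C * ((1 - alpha)^-1 + alpha^-1) /\
  `|levy_exp_im alpha t| <= C * ((1 - alpha)^-1 + alpha^-1).
Proof. exact: levy_trig_le. Qed.

(** Puts the target exponential in the unit disc, as the comparison of n-th powers requires. *)
Lemma levy_exp_re_le0 : levy_exp_re alpha t <= 0.
Proof.
have [ic _] := @levy_trig_integrable `]0%R, +oo[%classic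
  (measurable_itv _) (@subset_refl _ _).
rewrite -[leRHS](mul0r (fine (mu `]0%R, +oo[%classic))) -Rintegral_cst//.
apply: le_Rintegral => //.
  exact: integrable0.
by move=> x _; rewrite mulr_le0_ge0// ?subr_le0 ?cos_le1// invr_ge0 powR_ge0.
Qed.

End levy_trig.

(** * Pareto jumps *)

Lemma ge0_integrable_EFin {d} {T : measurableType d} {R : realType}
    (mu : {measure set T -> \bar R}) (D : set T) (f : T -> R) (r : R) :
  measurable_fun D f -> (forall x, D x -> 0 <= f x) ->
  (\int[mu]_(x in D) (f x)%:E <= r%:E)%E -> mu.-integrable D (EFin \o f).
Proof.
move=> mf f0 fr; apply/integrableP; split; first exact/measurable_EFinP.
rewrite (le_lt_trans _ (ltry r))//; apply: le_trans fr.
rewrite le_eqVlt; apply/orP; left; apply/eqP; apply: eq_integral => x /[!inE] Dx.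
by rewrite /= ger0_norm ?f0.
Qed.

Section pareto.
Context {R : realType}.
Notation mu := (@lebesgue_measure R).
Variables (alpha : R) (n : nat).
Hypothesis alpha01 : 0 < alpha < 1.
Hypothesis n0 : (0 < n)%N.

Let a0 : 0 < alpha. Proof. by case/andP: alpha01. Qed.
Let a1 : alpha < 1. Proof. by case/andP: alpha01. Qed.
Let nR : 0 < n%:R :> R. Proof. by rewrite ltr0n. Qed.

(* The Levy measure of [[cutoff, +oo[] is [n]. *)
Definition cutoff : R := (alpha * n%:R) `^ (- alpha^-1).

Lemma cutoff_gt0 : 0 < cutoff.
Proof. by rewrite powR_gt0// mulr_gt0. Qed.

Lemma powR_cutoff : alpha^-1 * cutoff `^ (- alpha) = n%:R.
Proof.
rewrite /cutoff -powRrM mulrNN mulVf ?gt_eqF// powRr1 ?mulr_ge0 ?(ltW a0)//.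
by rewrite mulrA mulVf ?gt_eqF// mul1r.
Qed.

Definition pareto_pdf : R -> R :=
  (fun x => n%:R^-1 * (1 / x `^ (alpha + 1))) \_ `]cutoff, +oo[.

Lemma pareto_pdf_ge0 x : 0 <= pareto_pdf x.
Proof.
apply: restrict_ge0 => y _.
by rewrite mulr_ge0 ?invr_ge0 ?(ltW nR)// div1r invr_ge0 powR_ge0.
Qed.

Lemma measurable_pareto_pdf : measurable_fun setT pareto_pdf.
Proof.
apply/measurable_restrict => //; apply: measurable_funM => //.
exact: (measurable_levy _ (phi := fun=> 1)).
Qed.

Lemma integral_pareto_pdf (b : R) : cutoff <= b ->
  (\int[mu]_(x in `]b, +oo[) (pareto_pdf x)%:E =
   (n%:R^-1 * (alpha^-1 * b `^ (- alpha)))%:E)%E.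
Proof.
move=> cb; have b0 := lt_le_trans cutoff_gt0 cb.
under eq_integral => x.
  rewrite inE/= in_itv/= andbT => bx.
  rewrite /pareto_pdf patchE mem_set/=; last first.
    by rewrite in_itv/= andbT (le_lt_trans cb).
  rewrite EFinM; over.
rewrite ge0_integralZl_EFin//= ?levy_tail//.
- by move=> x _; rewrite lee_fin div1r invr_ge0 powR_ge0.
- by apply/measurable_EFinP; exact: (measurable_levy _ (phi := fun=> 1)).
Qed.

Lemma integral_pareto_pdfT : (\int[mu]_x (pareto_pdf x)%:E = 1)%E.
Proof.
have := integral_pareto_pdf (lexx _); rewrite powR_cutoff mulVf ?gt_eqF// => <-.
rewrite [RHS]integral_mkcond; apply: eq_integral => x _.
by rewrite patchE; case: ifPn => // h; rewrite /pareto_pdf patchE (negbTE h).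
Qed.

Definition pareto_prob :=
  density_prob measurable_pareto_pdf pareto_pdf_ge0 integral_pareto_pdfT.

HB.instance Definition _ := Probability.on pareto_prob.

Lemma pareto_prob_tail (b : R) : cutoff <= b ->
  pareto_prob `]b, +oo[%classic = (n%:R^-1 * (alpha^-1 * b `^ (- alpha)))%:E.
Proof. exact: integral_pareto_pdf. Qed.

(** A Pareto value outside [A] is sent to 0, so the law of [jump A] has an atom there. *)
Definition jump (A : set R) (x : R) : R := x * \1_A x.

Lemma jumpT (A : set R) x : A x -> jump A x = x.
Proof. by move=> Ax; rewrite /jump indicE mem_set// mulr1. Qed.

Lemma jumpN (A : set R) x : ~ A x -> jump A x = 0.
Proof. by move=> Ax; rewrite /jump indicE memNset// mulr0. Qed.

Lemma measurable_jump (A : set R) : measurable A -> measurable_fun setT (jump A).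
Proof. by move=> mA; apply: measurable_funM => //; exact: measurable_indic. Qed.

(** [phi 0 = 0] removes the contribution of the atom at 0; on [A] the density is the Levy density
    divided by [n]. *)
Lemma Rintegral_jump (A : set R) (phi : R -> R) (M : R) :
  measurable A -> A `<=` `]cutoff, +oo[ -> measurable_fun setT phi ->
  phi 0 = 0 -> (forall x, `|phi (jump A x)| <= M) ->
  mu.-integrable A (EFin \o (fun x => phi x / x `^ (alpha + 1))) ->
  \int[pareto_prob]_x phi (jump A x) =
  n%:R^-1 * \int[mu]_(x in A) (phi x / x `^ (alpha + 1)).
Proof.
move=> mA sA mphi phi0 phiM iphi.
rewrite (@Rintegral_density_prob _ _ _ _ _ (phi \o jump A) M)//; last first.
  by apply: measurableT_comp => //; exact: measurable_jump.
rewrite -RintegralZl// [RHS]Rintegral_mkcond; apply: eq_Rintegral => x _ /=.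
rewrite patchE; case: ifPn => [/set_mem Ax|].
  rewrite jumpT// /pareto_pdf patchE mem_set; last exact: sA.
  by rewrite div1r mulrCA.
by rewrite notin_setE => nAx; rewrite jumpN// phi0 mul0r.
Qed.

Lemma integral_jump (A : set R) (phi : R -> R) (M : R) :
  measurable A -> A `<=` `]cutoff, +oo[ -> measurable_fun setT phi ->
  phi 0 = 0 -> (forall x, `|phi (jump A x)| <= M) ->
  mu.-integrable A (EFin \o (fun x => phi x / x `^ (alpha + 1))) ->
  (\int[pareto_prob]_x (phi (jump A x))%:E =
  (n%:R^-1 * \int[mu]_(x in A) (phi x / x `^ (alpha + 1)))%:E)%E.
Proof.
move=> mA sA mphi phi0 phiM iphi.
rewrite -(Rintegral_jump mA sA mphi phi0 phiM iphi) /Rintegral fineK//.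
apply: integrable_fin_num => //.
apply: (@bounded_integrable _ _ _ pareto_prob (phi \o jump A) M) => //.
by apply: measurableT_comp => //; exact: measurable_jump.
Qed.

Local Open Scope complex_scope.

Lemma charfun_jump (A : set R) t : measurable A -> A `<=` `]cutoff, +oo[ ->
  charfun pareto_prob (jump A) t =
   (1 + (\int[mu]_(x in A) ((cos (t * x) - 1) / x `^ (alpha + 1))) / n%:R) +i*
   ((\int[mu]_(x in A) (sin (t * x) / x `^ (alpha + 1))) / n%:R).
Proof.
move=> mA sA.
have sA0 : A `<=` `]0%R, +oo[.
  move=> x /sA /=; rewrite !in_itv/= !andbT; exact: lt_trans cutoff_gt0.
have mJ := measurable_jump mA.
have mcos (s : R) : measurable_fun setT (fun x : R => cos (s * x)).
  by apply: (@measurable_cosM R _ _ id); exact: measurable_id.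
have msin (s : R) : measurable_fun setT (fun x : R => sin (s * x)).
  by apply: (@measurable_sinM R _ _ id); exact: measurable_id.
have [ic isn] := levy_trig_integrable t alpha01 mA sA0.
rewrite /charfun; congr (_ +i* _).
(* The cosine does not vanish at the atom 0, [cos - 1] does; the subtracted constant is the leading
   1 of the statement. *)
- rewrite [in RHS]mulrC -(@Rintegral_jump A (fun x => cos (t * x) - 1) 2)//.
  + rewrite RintegralB//=.
    * by rewrite Rintegral_prob_cst; ring.
    * exact: integrable_cosM.
    * by apply: (@bounded_integrable _ _ _ _ _ 1) => // x; rewrite normr1.
  + exact: measurable_funB.
  + by rewrite mulr0 cos0 subrr.
  + move=> x; rewrite ler_norml; have := cos_geN1 (t * jump A x).
    by have := cos_le1 (t * jump A x); lra.
- rewrite [in RHS]mulrC -(@Rintegral_jump A (fun x => sin (t * x)) 1)//.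
  + by rewrite mulr0 sin0.
  + by move=> x; exact: sin_max.
Qed.

End pareto.

(** * Moments and tails of the approximants *)

Section second_moment.
Context {R : realType} {d : measure_display} {T : measurableType d}.
Variables (P : probability T R) (S : T -> R) (m V : R).
Hypotheses (mS : measurable_fun setT S) (S0 : forall x, 0 <= S x).
Hypothesis ES : (\int[P]_x (S x)%:E = m%:E)%E.
Hypothesis ES2 : (\int[P]_x (S x ^+ 2)%:E <= V%:E)%E.

Lemma integrable_indic_prob (A : set T) : measurable A ->
  P.-integrable setT (EFin \o (\1_A : T -> R)).
Proof.
move=> mA; apply: (@bounded_integrable _ _ _ _ _ 1).
  exact: measurable_indic.
by move=> x; rewrite indicE; case: (_ \in _); rewrite ?normr1 ?normr0.
Qed.

Lemma Rintegral_indic_prob (A : set T) : measurable A ->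
  \int[P]_x (\1_A x) = fine (P A).
Proof. by move=> mA; rewrite /Rintegral integral_indic// setIT. Qed.

Let iS : P.-integrable setT (EFin \o S).
Proof. by apply: (ge0_integrable_EFin (r := m)) => //; rewrite ES. Qed.

Let iS2 : P.-integrable setT (EFin \o (fun x => S x ^+ 2)).
Proof.
apply: (ge0_integrable_EFin (r := V)) => //.
  exact: measurable_funX.
by move=> x _; exact: sqr_ge0.
Qed.

Let RS : \int[P]_x S x = m.
Proof. by rewrite /Rintegral ES. Qed.

Let RS2 : \int[P]_x (S x ^+ 2) <= V.
Proof.
rewrite /Rintegral -lee_fin fineK//; exact: integrable_fin_num.
Qed.

Let icst (c : R) : P.-integrable setT (EFin \o (fun _ : T => c)).
Proof. by apply: (@bounded_integrable _ _ _ _ _ `|c|). Qed.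

(** As [V] bounds the second moment, [V - m^2] bounds the variance. The integrated inequality is
    [(a - m)^2 <= (S - m)^2] on the event, with the square expanded. *)
Lemma chebyshev_upper a : m < a ->
  fine (P [set w | a < S w]) <= (V - m ^+ 2) / (a - m) ^+ 2.
Proof.
move=> ma; have am : 0 < (a - m) ^+ 2 by rewrite exprn_gt0// subr_gt0.
have mA : measurable [set w | a < S w] by exact: measurable_gt_set.
rewrite ler_pdivlMr// -Rintegral_indic_prob//.
have iA := integrable_indic_prob mA.
have i1 : P.-integrable setT
    (EFin \o (fun x => \1_[set w | a < S w] x * (a - m) ^+ 2)).
  by apply: eq_integrable (integrableZr measurableT ((a - m) ^+ 2) iA).
have i2 : P.-integrable setT (EFin \o (fun x => 2 * m * S x)).
  by apply: eq_integrable (integrableZl measurableT (2 * m) iS).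
have : \int[P]_x (\1_[set w | a < S w] x * (a - m) ^+ 2 + 2 * m * S x) <=
    \int[P]_x (S x ^+ 2 + m ^+ 2).
  apply: le_Rintegral => //.
  - by apply: eq_integrable (integrableD measurableT i1 i2).
  - by apply: eq_integrable (integrableD measurableT iS2 (icst (m ^+ 2))).
  move=> x _; rewrite indicE.
  have [xa|xa] := boolP (x \in [set w | a < S w]).
    move: xa; rewrite inE/= mul1r => xa.
    have : 0 <= (S x - a) * (S x + a - 2 * m) by rewrite mulr_ge0//; lra.
    lra.
  by have := sqr_ge0 (S x - m); rewrite mul0r; lra.
rewrite RintegralD// RintegralD// RintegralZr// RintegralZl// RS.
rewrite Rintegral_prob_cst; have := RS2; lra.
Qed.

(** In place of Cauchy-Schwarz, a pointwise bound is integrated: [2 r S <= r^2 + S^2] where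
    [S >= tau], and [2 r S <= 2 r tau] elsewhere. With [r = V / (m - tau)], the best choice, this
    gives [V <= p r^2], where [p] is the probability of the event. *)
Lemma paley_zygmund tau : 0 <= tau -> tau < m -> 0 < V ->
  (m - tau) ^+ 2 / V <= fine (P [set w | tau <= S w]).
Proof.
move=> tau0 taum V0; have am : 0 < m - tau by rewrite subr_gt0.
have mA : measurable [set w | tau <= S w] by exact: measurable_ge_set.
pose r := V / (m - tau).
have r0 : 0 < r by rewrite divr_gt0.
have iA := integrable_indic_prob mA.
have i1 : P.-integrable setT
    (EFin \o (fun x => \1_[set w | tau <= S w] x * r ^+ 2)).
  by apply: eq_integrable (integrableZr measurableT (r ^+ 2) iA).
have i2 : P.-integrable setT (EFin \o (fun x => 2 * r * S x)).
  by apply: eq_integrable (integrableZl measurableT (2 * r) iS).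
have i3 : P.-integrable setT (EFin \o (fun x => 2 * r * tau + S x ^+ 2)).
  by apply: eq_integrable (integrableD measurableT (icst (2 * r * tau)) iS2).
have : \int[P]_x (2 * r * S x) <=
    \int[P]_x ((2 * r * tau + S x ^+ 2) + \1_[set w | tau <= S w] x * r ^+ 2).
  apply: le_Rintegral => //.
  - by apply: eq_integrable (integrableD measurableT i3 i1).
  move=> x _; rewrite indicE.
  have [xa|xa] := boolP (x \in [set w | tau <= S w]).
    have := sqr_ge0 (S x - r); have : 0 <= r * tau by exact: mulr_ge0 (ltW r0) tau0.
    by rewrite mul1r; lra.
  move: xa; rewrite notin_setE/= => /negP; rewrite -ltNge => xa.
  by rewrite mul0r addr0; have := sqr_ge0 (S x); nra.
have -> : \int[P]_x (2 * r * S x) = 2 * r * m by rewrite RintegralZl// RS.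
rewrite RintegralD//.
have -> : \int[P]_x (2 * r * tau + S x ^+ 2) =
    2 * r * tau + \int[P]_x (S x ^+ 2).
  by rewrite RintegralD// Rintegral_prob_cst.
have -> : \int[P]_x (\1_[set w | tau <= S w] x * r ^+ 2) =
    fine (P [set w | tau <= S w]) * r ^+ 2.
  by rewrite RintegralZr// Rintegral_indic_prob.
set p := fine _ => h.
have {}h : 2 * r * (m - tau) <= V + p * r ^+ 2 by have := RS2; lra.
have e : r * (m - tau) = V by rewrite /r divfK// gt_eqF.
rewrite ler_pdivrMr//.
have h1 : V <= p * r ^+ 2 by rewrite -mulrA e in h; lra.
have : V * (m - tau) ^+ 2 <= p * r ^+ 2 * (m - tau) ^+ 2.
  by rewrite ler_wpM2r// sqr_ge0.
rewrite -mulrA -exprMn e expr2 -[X in X <= _](mulrC) => h2.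
rewrite -(ler_pM2r V0); lra.
Qed.

End second_moment.

(** * A bounded subadditive function for tightness *)

Section capped.
Context {R : realType}.
Variable M : R.
Hypothesis M0 : 0 < M.

(** At least the indicator of [x >= M], so its mean bounds that tail; unlike [x / M], it is
    integrable for large jumps. *)
Definition capped (x : R) : R := Num.min 1 (`|x| / M).

Lemma capped_ge0 x : 0 <= capped x.
Proof. by rewrite le_min ler01 divr_ge0// ltW. Qed.

Lemma capped_le1 x : capped x <= 1.
Proof. by rewrite ge_min lexx. Qed.

Lemma measurable_capped : measurable_fun setT capped.
Proof.
by apply: measurable_minr => //; exact: measurable_funM.
Qed.

Lemma capped_subadditive : subadditive_ge0 capped.
Proof.
split.
- exact: measurable_capped.
- exact: capped_ge0.
- by rewrite /capped normr0 mul0r; apply/min_idPr.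
- move=> x y x0 y0.
  have := capped_ge0 x; have := capped_ge0 y.
  rewrite /capped !ger0_norm ?addr_ge0// mulrDl.
  move: (x / M) (y / M) => p q.
  by rewrite /Num.min /Order.min; do 3 case: ltP => ?; lra.
Qed.

Lemma capped_large x : M <= x -> capped x = 1.
Proof.
move=> Mx; apply/min_idPl; rewrite ger0_norm ?(le_trans (ltW M0))//.
by rewrite ler_pdivlMr// mul1r.
Qed.

End capped.

(** * The sums of small and of large jumps *)

Section stable_approximation.
Context {R : realType}.
Notation mu := (@lebesgue_measure R).
Variables (alpha c : R) (n : nat).
Hypothesis alpha01 : 0 < alpha < 1.
Hypothesis n0 : (0 < n)%N.

Let a0 : 0 < alpha. Proof. by case/andP: alpha01. Qed.
Let a1 : alpha < 1. Proof. by case/andP: alpha01. Qed.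
Let nR : 0 < n%:R :> R. Proof. by rewrite ltr0n. Qed.
Let nRn0 : n%:R != 0 :> R. Proof. by rewrite gt_eqF. Qed.

Local Notation eps := (cutoff alpha n).
Local Notation Q := (pareto_prob alpha01 n0).

Let eps0 : 0 < eps. Proof. exact: cutoff_gt0. Qed.

Hypothesis eps_c : eps < c.

Let c0 : 0 < c. Proof. exact: lt_trans eps_c. Qed.

Definition small_mean : R := (1 - alpha)^-1 * (c `^ (1 - alpha) - eps `^ (1 - alpha)).
(** Bounds [n] times the second moment of a small jump, hence the variance of the sum; the negative
    term at [eps] is dropped. *)
Definition small_var : R := (2 - alpha)^-1 * c `^ (2 - alpha).
(** The bound of [levy_Rintegral_le] with [C1 = 1 / M], [C2 = 1] and cut at [M], where both terms
    scale as [M^(-alpha)]. *)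
Definition capped_bound M : R := ((1 - alpha)^-1 + alpha^-1) * M `^ (- alpha).

Lemma capped_jump_le (A : set R) M : 0 < M -> measurable A ->
  A `<=` `]eps, +oo[ ->
  (\int[Q]_x (capped M (jump A x))%:E <= (n%:R^-1 * capped_bound M)%:E)%E.
Proof.
move=> M0 mA sA.
have sA0 : A `<=` `]0%R, +oo[.
  by move=> x /sA /=; rewrite !in_itv/= !andbT; exact: lt_trans.
have Mi0 : 0 <= M^-1 by rewrite invr_ge0 ltW.
have h1 x : 0 < x -> `|capped M x| <= M^-1 * x.
  move=> x0; rewrite ger0_norm ?capped_ge0// /capped ge_min; apply/orP; right.
  by rewrite gtr0_norm// mulrC.
have h2 x : 0 < x -> `|capped M x| <= 1.
  by move=> x0; rewrite ger0_norm ?capped_ge0// capped_le1.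
have ic := levy_integrableS alpha01 (measurable_capped M) Mi0 ler01 h1 h2 mA sA0.
have cM0 : capped M 0 = 0 by rewrite /capped normr0 mul0r; apply/min_idPr.
have hb x : `|capped M (jump A x)| <= 1.
  by rewrite ger0_norm ?capped_ge0// capped_le1.
rewrite (integral_jump alpha01 n0 mA sA (measurable_capped M) cM0 hb ic).
rewrite lee_fin ler_wpM2l ?invr_ge0 ?(ltW nR)//.
apply: (le_trans (ler_norm _)).
apply: (le_trans (levy_Rintegral_le alpha01 (measurable_capped M) Mi0 ler01 h1 h2
  mA sA0 M0)).
rewrite le_eqVlt; apply/orP; left; apply/eqP.
have -> : M `^ (1 - alpha) = M * M `^ (- alpha).
  rewrite powRD; first by rewrite powRr1// ltW.
  by rewrite (gt_eqF M0) implybT.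
by rewrite /capped_bound; field; rewrite !gt_eqF// subr_gt0.
Qed.

Lemma small_jump_moments :
  (\int[Q]_x (jump `]eps, c] x)%:E = (n%:R^-1 * small_mean)%:E)%E /\
  exists2 v, v <= small_var &
  (\int[Q]_x (jump `]eps, c] x ^+ 2)%:E = (n%:R^-1 * v)%:E)%E.
Proof.
have sA : `]eps, c]%classic `<=` `]eps, +oo[.
  by move=> x /=; rewrite !in_itv/= => /andP[->].
have pos x : `]eps, c]%classic x -> 0 < x.
  by rewrite /= in_itv/= => /andP[h _]; exact: lt_trans h.
have jb x : 0 <= jump `]eps, c] x <= c.
  have [h|h] := pselect (`]eps, c]%classic x).
    by rewrite jumpT// ltW ?pos//=; move: h; rewrite /= in_itv/= => /andP[].
  by rewrite jumpN// lexx ltW.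
have I1 : (\int[mu]_(x in `]eps, c]) (x / x `^ (alpha + 1))%:E = small_mean%:E)%E.
  under eq_integral => x.
    rewrite inE => /pos x0; rewrite levy_weight1//; over.
  by rewrite integral_powR// gt_eqF// subr_gt0.
have I2 : (\int[mu]_(x in `]eps, c]) (x ^+ 2 / x `^ (alpha + 1))%:E =
    ((2 - alpha)^-1 * (c `^ (2 - alpha) - eps `^ (2 - alpha)))%:E)%E.
  under eq_integral => x.
    rewrite inE => /pos x0; rewrite levy_weight2//; over.
  by rewrite integral_powR// gt_eqF// subr_gt0 (lt_trans a1)// ltr1n.
have mid : measurable_fun setT (fun x : R => x) by exact: measurable_id.
have msq : measurable_fun setT (fun x : R => x ^+ 2) by exact: measurable_funX.
split.
  rewrite (@integral_jump _ _ _ alpha01 n0 _ (fun x => x) c)//.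
  - by rewrite /Rintegral I1.
  - by move=> x; have /andP[h1 h2] := jb x; rewrite ger0_norm.
  - apply: (ge0_integrable_EFin (r := small_mean)); last by rewrite I1.
      exact: (measurable_levy _ mid).
    by move=> x /pos x0; rewrite divr_ge0 ?powR_ge0 ?ltW.
exists ((2 - alpha)^-1 * (c `^ (2 - alpha) - eps `^ (2 - alpha))).
  by rewrite ler_wpM2l ?gerBl ?powR_ge0// invr_ge0; have := a1; lra.
rewrite (@integral_jump _ _ _ alpha01 n0 _ (fun x => x ^+ 2) (c ^+ 2))//.
- by rewrite /Rintegral I2.
- by rewrite expr0n.
- move=> x; have /andP[h1 h2] := jb x; rewrite ger0_norm ?sqr_ge0//.
  by rewrite ler_pXn2r// nnegrE ltW.
- apply: (ge0_integrable_EFin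
    (r := (2 - alpha)^-1 * (c `^ (2 - alpha) - eps `^ (2 - alpha)))).
  + exact: (measurable_levy _ msq).
  + by move=> x /pos x0; rewrite divr_ge0 ?powR_ge0 ?sqr_ge0.
  + by rewrite I2.
Qed.

Lemma small_sum :
  exists d (T : measurableType d) (P : probability T R) (S : T -> R),
  [/\ measurable_fun setT S /\ (forall x, 0 <= S x),
      (forall t, charfun P S t = charfun Q (jump `]eps, c]) t ^+ n),
      (\int[P]_x (S x)%:E = small_mean%:E)%E,
      (\int[P]_x (S x ^+ 2)%:E <= (small_var + small_mean ^+ 2)%:E)%E &
      (forall M, 0 < M -> (\int[P]_x (capped M (S x))%:E <= (capped_bound M)%:E)%E)].
Proof.
have mA : measurable `]eps, c]%classic by exact: measurable_itv.
have j0 x : 0 <= jump `]eps, c] x.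
  have [h|h] := pselect (`]eps, c]%classic x); last by rewrite jumpN.
  rewrite jumpT//; move: h; rewrite /= in_itv/= => /andP[h _].
  by rewrite ltW// (lt_trans _ h).
have [d [T [P [S [mS0 chS mom sub _]]]]] := iid_sum Q n (measurable_jump mA) j0.
have [e1 [v vle e2]] := small_jump_moments.
have [E1 E2] := mom _ _ e1 e2.
exists d, T, P, S; split => //.
- by rewrite E1 mulrA mulfV// mul1r.
- rewrite E2 lee_fin mulrA mulfV// mul1r lerD// exprMn.
  have -> : n%:R * (n%:R - 1) * (n%:R^-1 ^+ 2 * small_mean ^+ 2) =
     (1 - n%:R^-1) * small_mean ^+ 2 by field.
  by rewrite ler_piMl ?sqr_ge0// gerBl invr_ge0 ltW.
- move=> M M0; have := sub _ _ (capped_subadditive M0) (capped_jump_le M0 mA _).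
  rewrite mulrA mulfV// mul1r; apply.
  by move=> x /=; rewrite !in_itv/= => /andP[->].
Qed.

Lemma large_sum :
  exists d (T : measurableType d) (P : probability T R) (L : T -> R),
  [/\ measurable_fun setT L /\ (forall x, 0 <= L x),
      (forall t, charfun P L t = charfun Q (jump `]c, +oo[) t ^+ n),
      (P [set w | (0 < L w)%R] <= (alpha^-1 * c `^ (- alpha))%:E)%E,
      (forall y, c <= y -> (P [set w | (L w < y)%R] <=
        ((1 - n%:R^-1 * (alpha^-1 * y `^ (- alpha))) ^+ n)%:E)%E) &
      (forall M, 0 < M -> (\int[P]_x (capped M (L x))%:E <= (capped_bound M)%:E)%E)].
Proof.
have mA : measurable `]c, +oo[%classic by exact: measurable_itv.
have mJ := measurable_jump mA.
have j0 x : 0 <= jump `]c, +oo[ x.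
  have [h|h] := pselect (`]c, +oo[%classic x); last by rewrite jumpN.
  rewrite jumpT//; move: h; rewrite /= in_itv/= andbT => h.
  by rewrite ltW// (lt_trans _ h).
have [d [T [P [L [[mL L0] chL _ sub tail]]]]] := iid_sum Q n mJ j0.
exists d, T, P, L; split => //.
(* Subadditivity of the indicator of the positive reals expresses the union bound: a positive sum
   has a positive term. *)
- pose h (x : R) : R := \1_`]0%R, +oo[%classic x.
  have hE (x : R) : h x = (0 < x)%R%:R.
    by rewrite /h indicE; congr (_%:R); congr nat_of_bool; apply/idP/idP;
      rewrite inE/= in_itv/= andbT.
  have mh : measurable_fun setT h by exact: measurable_indic.
  have sh : subadditive_ge0 h.
    split => //.
    - by rewrite hE ltxx.
    - move=> x y x0 y0; rewrite !hE.
      have [xp|xn] := ltP 0 x; first by case: (0 < x + y); case: (0 < y) => /=; lra.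
      have -> : x = 0 by apply/eqP; rewrite eq_le xn x0.
      by rewrite !add0r.
  have e : (\int[Q]_x (h (jump `]c, +oo[ x))%:E <=
      (n%:R^-1 * (alpha^-1 * c `^ (- alpha)))%:E)%E.
    rewrite -(pareto_prob_tail alpha01 n0 (ltW eps_c)).
    rewrite -[X in (_ <= _ X)%E]setIT -integral_indic//.
    rewrite le_eqVlt; apply/orP; left; apply/eqP; apply: eq_integral => x _.
    congr EFin; have [Ax|Ax] := pselect (`]c, +oo[%classic x).
      rewrite jumpT// hE indicE mem_set//; move: Ax; rewrite /= in_itv/= andbT => cx.
      by rewrite (lt_trans c0 cx).
    by rewrite jumpN// hE ltxx indicE memNset.
  have := sub _ _ sh e; rewrite mulVKf// => h1.
  apply: le_trans h1; rewrite -[X in (P X <= _)%E]setIT -integral_indic//; last first.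
    exact: measurable_gt_set.
  rewrite le_eqVlt; apply/orP; left; apply/eqP; apply: eq_integral => x _.
  congr EFin; rewrite hE indicE; congr (_%:R); congr nat_of_bool.
  by apply/idP/idP; rewrite inE.
(* As [c <= y], a value beyond [y] is not sent to 0, so [jump < y] can hold only outside []y,
   +oo[]. *)
- move=> y cy; apply: tail.
  have ey : eps <= y by exact: le_trans (ltW eps_c) cy.
  have mB : measurable `]y, +oo[%classic by exact: measurable_itv.
  rewrite EFinB -(pareto_prob_tail alpha01 n0 ey) -(probability_setC Q mB).
  apply: le_measure; rewrite ?inE.
  + exact: measurable_lt_set.
  + exact: measurableC.
  + move=> x /= xy yx; move: xy; rewrite jumpT.
      by move: yx; rewrite in_itv/= andbT => /lt_trans h /h; rewrite ltxx.
    by move: yx; rewrite /= !in_itv/= !andbT; exact: le_lt_trans.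
- move=> M M0; have := sub _ _ (capped_subadditive M0) (capped_jump_le M0 mA _).
  rewrite mulrA mulfV// mul1r; apply.
  by move=> x /=; rewrite !in_itv/= !andbT; exact: lt_trans.
Qed.

End stable_approximation.

(** * Weak limits *)

(** Continuity from below along [[a + 1/(k+1), k+1]]. The gap between [a] and [b] leaves room for a
    continuous step, and [M] confines the event to the range where the step is controlled. *)
Lemma prob_gt_approx {R : realType} {d} {T : measurableType d}
    (P : probability T R) (X : T -> R) (a e : R) :
  measurable_fun setT X -> 0 < e -> exists b M, [/\ a < b, 0 < M &
    fine (P [set w | a < X w]) <= fine (P [set w | b <= X w <= M]) + e].
Proof.
move=> mX e0.
pose F (k : nat) := [set w | a + k.+1%:R^-1 <= X w <= k.+1%:R].
have mF k : measurable (F k).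
  rewrite (_ : F k = [set w | a + k.+1%:R^-1 <= X w] `&` ~` [set w | k.+1%:R < X w]).
    apply: measurableI; first exact: measurable_ge_set.
    by apply: measurableC; exact: measurable_gt_set.
  apply/seteqP; split => w /=; rewrite /F/=.
    by move=> /andP[h1 h2]; split => //; apply/negP; rewrite -leNgt.
  by move=> [-> /negP]; rewrite -leNgt.
have UF : \bigcup_k F k = [set w | a < X w].
  apply/seteqP; split => w /=.
    move=> [k _] /andP[h _]; rewrite (lt_le_trans _ h)// ltrDl invr_gt0.
    by rewrite ltr0n.
  move=> aX; have aX0 : 0 < X w - a by rewrite subr_gt0.
  have h1 := archi_boundP (ltW (etrans (invr_gt0 _) aX0)).
  have h2 := archi_boundP (normr_ge0 (X w)).
  move: h1 h2; set p := Num.bound _; set q := Num.bound _ => h1 h2.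
  exists (maxn p q) => //; apply/andP; split.
    rewrite -lerBrDl -[leRHS]invrK lef_pV2 ?posrE ?invr_gt0 ?ltr0n//.
    rewrite (le_trans (ltW h1))// ler_nat (leq_trans (leq_maxl p q))//.
  rewrite (le_trans (ler_norm _))// (le_trans (ltW h2))// ler_nat.
  by rewrite (leq_trans (leq_maxr p q)).
have ndF : nondecreasing_seq F.
  move=> i j ij; apply/subsetPset => w /= /andP[h1 h2]; apply/andP; split.
    by rewrite (le_trans _ h1)// lerD2l lef_pV2 ?posrE ?ltr0n// ler_nat.
  by rewrite (le_trans h2)// ler_nat.
have mU : measurable (\bigcup_k F k) by exact: bigcup_measurable.
have cv := nondecreasing_cvg_mu mF mU ndF (mu := P).
have fP A : measurable A -> P A \is a fin_num by move=> mA; exact: fin_num_measure.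
have : fine (P (F k)) @[k --> \oo] --> fine (P (\bigcup_k F k)).
  by apply: fine_cvg; rewrite fineK ?fP.
move=> /cvgrPdist_lt /(_ e e0) [N _ /(_ N (leqnn N))] /=.
rewrite UF => h; exists (a + N.+1%:R^-1), N.+1%:R; split.
- by rewrite ltrDl invr_gt0 ltr0n.
- by rewrite ltr0n.
- by rewrite -lerBlDl (le_trans (ler_norm _))// ltW.
Qed.

Section weak_limit.
Context {R : realType} {dX : measure_display} {TX : measurableType dX}.
Variables (PX : probability TX R) (X : TX -> R).
Hypothesis mX : measurable_fun setT X.
Variable delta : nat -> R -> R.
Hypothesis delta0 : forall t e, 0 < e ->
  exists N, forall n, (N <= n)%N -> delta n t <= e.
Local Open Scope complex_scope.

(** The space is a parameter because each approximant lives on its own. *)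
Definition charfun_close n {d} {T : measurableType d} (P : probability T R)
    (Y : T -> R) :=
  forall t, `|charfun P Y t - charfun PX X t| <= (delta n t)%:C.

Lemma integrable_trigpoly f {d} {T : measurableType d} (P : probability T R)
    (Y : T -> R) : measurable_fun setT Y -> trigpoly f ->
  P.-integrable setT (EFin \o (fun x => f (Y x))).
Proof.
move=> mY tf.
have [M fM] : exists M, forall x, `|f x| <= M.
  elim: tf => [t s|f1 f2 _ [M1 h1] _ [M2 h2]|c f1 _ [M1 h1]].
  - by exists 1 => x; exact: cos_max.
  - by exists (M1 + M2) => x; rewrite (le_trans (ler_normD _ _))// lerD.
  - by exists (`|c| * M1) => x; rewrite normrM ler_wpM2l.
apply: (@bounded_integrable _ _ _ _ _ M) => [|x]; last exact: fM.
apply: (@measurableT_comp _ _ _ _ _ _ f) => //.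
by apply: continuous_measurable_fun; exact: trigpoly_continuous.
Qed.

(** [N] is chosen before the space and the variable, so the convergence applies to whichever
    approximant is supplied later. *)
Lemma trigpoly_limit f : trigpoly f -> forall e, 0 < e ->
  exists N, forall n, (N <= n)%N -> forall d (T : measurableType d)
    (P : probability T R) (Y : T -> R), measurable_fun setT Y ->
    charfun_close n P Y -> `|\int[P]_x f (Y x) - \int[PX]_x f (X x)| <= e.
Proof.
elim=> [t s|f1 f2 t1 IH1 t2 IH2|c f1 t1 IH1] e e0.
- have [N hN] := delta0 t (divr_gt0 e0 (ltr0n R 2)).
  exists N => n /hN dn d T P Y mY cl.
  have E d' (T' : measurableType d') (P' : probability T' R) (Y' : T' -> R) :
      measurable_fun setT Y' -> \int[P']_x cos (t * Y' x + s) =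
      cos s * complex.Re (charfun P' Y' t) + - sin s * complex.Im (charfun P' Y' t).
    move=> mY'; rewrite -Rintegral_lin_cos_sin//; apply: eq_Rintegral => x _.
    by rewrite cosD; ring.
  rewrite !E//.
  have [] := re_im_norm_le (cl t).
  case: (charfun P Y t) => p q; case: (charfun PX X t) => p' q' /= h1 h2.
  have -> : cos s * p + - sin s * q - (cos s * p' + - sin s * q') =
    cos s * (p - p') - sin s * (q - q') by ring.
  rewrite (le_trans (ler_normB _ _))// !normrM.
  have := cos_max s; have := sin_max s => hs hc.
  have u1 : `|cos s| * `|p - p'| <= `|p - p'| by rewrite ler_piMl.
  have u2 : `|sin s| * `|q - q'| <= `|q - q'| by rewrite ler_piMl.
  lra.
- have e2 : 0 < e / 2 by rewrite divr_gt0.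
  have [N1 h1] := IH1 _ e2; have [N2 h2] := IH2 _ e2.
  exists (maxn N1 N2) => n; rewrite geq_max => /andP[n1 n2] d T P Y mY cl.
  have k1 := h1 _ n1 _ _ _ _ mY cl; have k2 := h2 _ n2 _ _ _ _ mY cl.
  rewrite !RintegralD//; try exact: integrable_trigpoly.
  rewrite opprD addrACA (le_trans (ler_normD _ _))//; lra.
(* Adding 1 covers the case [c = 0] in the division. *)
- have c1 : 0 < `|c| + 1 by rewrite ltr_wpDl.
  have [N1 h1] := IH1 _ (divr_gt0 e0 c1).
  exists N1 => n n1 d T P Y mY cl.
  have k1 := h1 _ n1 _ _ _ _ mY cl.
  rewrite !RintegralZl//; try exact: integrable_trigpoly.
  rewrite -mulrBr normrM.
  apply: (@le_trans _ _ ((`|c| + 1) * (e / (`|c| + 1)))).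
    by rewrite ler_pM// lerDl.
  by rewrite mulrC divfK// gt_eqF.
Qed.

(** [f] is small on [[-M', a]], which contains every value of [Y] outside the event [Y > a], as
    [Y >= 0]. Its behaviour beyond [M'] is harmless, since only [0 <= f <= 1] is used there. *)
Lemma weak_limit_upper a B : 0 <= a ->
  (forall e, 0 < e -> exists N, forall n, (N <= n)%N ->
    exists d (T : measurableType d) (P : probability T R) (Y : T -> R),
    [/\ measurable_fun setT Y, (forall x, 0 <= Y x), charfun_close n P Y &
      fine (P [set w | a < Y w]) <= B + e]) ->
  fine (PX [set w | a < X w]) <= B.
Proof.
move=> a_ge0 H; apply/ler_addgt0Pr => e e0.
(* One fifth each for: confining [X], the step below [a], the step above [b], the change of law, and
   the bound on [Y]. *)
pose h := e / 5; have h0 : 0 < h by rewrite divr_gt0.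
have [b [M [ab M0 PaX]]] := prob_gt_approx PX a mX h0.
pose M' := b + M + 1.
have b0 : 0 < b by exact: le_lt_trans ab.
have [||f [tf f01 fl fr]] := @trigpoly_step R a b M' h _ ab _ h0.
- by rewrite /M'; lra.
- by rewrite /M'; lra.
have [N1 hN1] := trigpoly_limit tf h0.
have [N2 hN2] := H _ h0.
pose n := maxn N1 N2.
have [d [T [P [Y [mY Y0 cl PY]]]]] := hN2 n (leq_maxr _ _).
have lim := hN1 n (leq_maxl _ _) _ _ _ _ mY cl.
have mYa : measurable [set w | a < Y w] by exact: measurable_gt_set.
have mXb : measurable [set w | b <= X w <= M].
  rewrite (_ : [set _ | _] = [set w | b <= X w] `&` ~` [set w | M < X w]).
    apply: measurableI; first exact: measurable_ge_set.
    by apply: measurableC; exact: measurable_gt_set.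
  apply/seteqP; split => w /=.
    by move=> /andP[h1 h2]; split => //; apply/negP; rewrite -leNgt.
  by move=> [-> /negP]; rewrite -leNgt.
have EY : \int[P]_x f (Y x) <= h + fine (P [set w | a < Y w]).
  rewrite -Rintegral_indic_prob// -[X in X + _](Rintegral_prob_cst P h).
  have ih : P.-integrable setT (EFin \o (fun _ : T => h)).
    by apply: (@bounded_integrable _ _ _ _ _ `|h|).
  have iI := integrable_indic_prob P mYa.
  rewrite -RintegralD//; apply: le_Rintegral => //.
  - exact: integrable_trigpoly.
  - by apply: eq_integrable (integrableD measurableT ih iI).
  move=> x _; rewrite indicE; have [xa|] := boolP (x \in _).
    by have /andP[_] := f01 (Y x); rewrite /=; lra.
  rewrite notin_setE/= => /negP; rewrite -leNgt => Ya; rewrite addr0 fl//.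
  by have := Y0 x; rewrite /M'; lra.
have EX : fine (PX [set w | b <= X w <= M]) <= \int[PX]_x f (X x) + h.
  rewrite -Rintegral_indic_prob// -[X in _ + X](Rintegral_prob_cst PX h).
  have ih : PX.-integrable setT (EFin \o (fun _ : TX => h)).
    by apply: (@bounded_integrable _ _ _ _ _ `|h|).
  have i4 := integrable_trigpoly PX mX tf.
  rewrite -RintegralD//; apply: le_Rintegral => //.
  - exact: integrable_indic_prob.
  - by apply: eq_integrable (integrableD measurableT i4 ih).
  move=> x _; rewrite indicE; have [|xa] := boolP (x \in _); last first.
    by have /andP[? _] := f01 (X x); rewrite addr_ge0// ltW.
  rewrite inE/= => /andP[bx xM]; have := fr (X x).
  rewrite bx/= (_ : X x <= M') => [/(_ isT)|]; last by rewrite /M'; lra.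
  by rewrite /=; lra.
by move: lim; rewrite ler_norml => /andP[l1 l2]; rewrite /h in PY EY EX PaX l1 l2; lra.
Qed.

(** Here [f] must be near 1 whenever [Y >= b], which may fail beyond [M']. The bound [kappa],
    uniform in [n], makes that tail negligible and is the sixth error term. *)
Lemma weak_limit_lower b B (kappa : R -> R) :
  (forall e, 0 < e -> exists2 M, 0 < M & forall M', M <= M' -> kappa M' <= e) ->
  (forall e, 0 < e -> exists N, forall n, (N <= n)%N ->
    exists d (T : measurableType d) (P : probability T R) (Y : T -> R),
    [/\ measurable_fun setT Y, charfun_close n P Y,
      (forall M, 0 < M -> fine (P [set w | M < Y w]) <= kappa M) &
      fine (P [set w | Y w < b]) <= B + e]) ->
  fine (PX [set w | X w < b]) <= B.
Proof.
move=> kap H; apply/ler_addgt0Pr => e e0.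
pose h := e / 6; have h0 : 0 < h by rewrite divr_gt0.
have mNX : measurable_fun setT (fun x => - X x) by exact: measurableT_comp.
(* Applied to [-X]: up to [h], the event [X < b] is [-M <= X <= -a']. *)
have [a' [M [ba' M0 PaX]]] := prob_gt_approx PX (- b) mNX h0.
have [M1 M10 kM1] := kap _ h0.
pose a := - a'; have ab : a < b by rewrite /a; lra.
(* Large enough to contain [a], [b] and the range of the confined [X], and for the tail of [Y]
   beyond it to be at most [h]. *)
pose M' := `|a| + `|b| + M + M1 + 1.
have a1 : `|a| >= - a by rewrite ler_normr lexx orbT.
have b1 : `|b| >= b by rewrite ler_norm.
have na := normr_ge0 a; have nb := normr_ge0 b.
have [||f [tf f01 fl fr]] := @trigpoly_step R a b M' h _ ab _ h0.
- by rewrite /M'; lra.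
- by rewrite /M'; lra.
have [N1 hN1] := trigpoly_limit tf h0.
have [N2 hN2] := H _ h0.
pose n := maxn N1 N2.
have [d [T [P [Y [mY cl tY PY]]]]] := hN2 n (leq_maxr _ _).
have lim := hN1 n (leq_maxl _ _) _ _ _ _ mY cl.
have tM' : fine (P [set w | M' < Y w]) <= h.
  have M'0 : 0 < M' by rewrite /M'; lra.
  by rewrite (le_trans (tY _ M'0))// kM1// /M'; lra.
have mYb : measurable [set w | Y w < b] by exact: measurable_lt_set.
have mYM : measurable [set w | M' < Y w] by exact: measurable_gt_set.
have mXa : measurable [set w | a' <= - X w <= M].
  rewrite (_ : [set _ | _] = [set w | a' <= - X w] `&` ~` [set w | M < - X w]).
    apply: measurableI; first exact: measurable_ge_set.
    by apply: measurableC; exact: measurable_gt_set.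
  apply/seteqP; split => w /=.
    by move=> /andP[h1 h2]; split => //; apply/negP; rewrite -leNgt.
  by move=> [-> /negP]; rewrite -leNgt.
have EY : 1 - h <= \int[P]_x f (Y x) +
    (fine (P [set w | (Y w < b)%R]) + fine (P [set w | (M' < Y w)%R])).
  rewrite -!Rintegral_indic_prob// -[leLHS](Rintegral_prob_cst P).
  have ih : P.-integrable setT (EFin \o (fun _ : T => 1 - h)).
    by apply: (@bounded_integrable _ _ _ _ _ `|1 - h|).
  have i1 := integrable_indic_prob P mYb.
  have i2 := integrable_indic_prob P mYM.
  have i3 : P.-integrable setT (EFin \o (fun x =>
      \1_[set w | (Y w < b)%R] x + \1_[set w | (M' < Y w)%R] x : R)).
    by apply: eq_integrable (integrableD measurableT i1 i2).
  have i4 := integrable_trigpoly P mY tf.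
  rewrite -RintegralD// -RintegralD//; apply: le_Rintegral => //.
    by apply: eq_integrable (integrableD measurableT i4 i3).
  move=> x _; have /andP[f0 f1] := f01 (Y x); rewrite !indicE.
  have [xa|] := boolP (x \in [set w | Y w < b]).
    have : 0 <= (x \in [set w | M' < Y w])%:R :> R by [].
    by rewrite /=; lra.
  rewrite notin_setE/= => /negP; rewrite -leNgt => Yb.
  have [xM|] := boolP (x \in [set w | M' < Y w]); first by rewrite /=; lra.
  rewrite notin_setE/= => /negP; rewrite -leNgt => YM; rewrite !addr0.
  by apply: fr; rewrite Yb YM.
have EX : \int[PX]_x f (X x) + fine (PX [set w | (a' <= - X w <= M)%R]) <= 1 + h.
  rewrite -Rintegral_indic_prob// -[leRHS](Rintegral_prob_cst PX).
  have ih : PX.-integrable setT (EFin \o (fun _ : TX => 1 + h)).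
    by apply: (@bounded_integrable _ _ _ _ _ `|1 + h|).
  have i1 := integrable_indic_prob PX mXa.
  have i4 := integrable_trigpoly PX mX tf.
  rewrite -RintegralD//; apply: le_Rintegral => //.
    by apply: eq_integrable (integrableD measurableT i4 i1).
  move=> x _; have /andP[f0 f1] := f01 (X x); rewrite !indicE.
  have [|xa] := boolP (x \in _); last by rewrite addr0; lra.
  rewrite inE/= => /andP[h1 h2].
  have : f (X x) <= h by apply: fl; rewrite /a /M'; apply/andP; split; lra.
  lra.
have -> : [set w | X w < b] = [set w | - b < - X w].
  by apply/seteqP; split => w /=; rewrite ltrN2.
by move: lim; rewrite ler_norml => /andP[l1 l2];
  rewrite /h in tM' PY EY EX PaX l1 l2; lra.
Qed.

End weak_limit.

(** * The stable law *)

Section approximants.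
Context {R : realType}.
Notation mu := (@lebesgue_measure R).
Variables (alpha c : R) (n : nat).
Hypothesis alpha01 : 0 < alpha < 1.
Hypothesis n0 : (0 < n)%N.
Local Notation eps := (cutoff alpha n).
Hypothesis eps_c : eps < c.
Local Notation m := (small_mean alpha c n).
Local Notation v := (small_var alpha c).

(** The error of [charfun_powers_close], with [e] the cost of cutting jumps below [eps] and [K] the
    common bound on all exponents. *)
Definition approx_error (t : R) : R :=
  2 * ((`|t| + 2) * ((1 - alpha)^-1 * eps `^ (1 - alpha))) +
  10 * ((`|t| + 2) * ((1 - alpha)^-1 + alpha^-1)) ^+ 2 / n%:R.

Local Open Scope complex_scope.

(** The last three clauses serve tightness, the upper bound and the lower bound; [c] is fixed only
    by the users. *)
Lemma stable_approx :
  exists d (T : measurableType d) (P : probability T R) (Y : T -> R),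
  [/\ measurable_fun setT Y /\ (forall x, 0 <= Y x),
    (forall t, `|charfun P Y t - cexp (levy_exp_re alpha t) (levy_exp_im alpha t)|
       <= (approx_error t)%:C),
    (forall M, 0 < M -> fine (P [set w | M < Y w]) <= 2 * capped_bound alpha M),
    (forall a, m < a -> fine (P [set w | a < Y w]) <=
       v / (a - m) ^+ 2 + alpha^-1 * c `^ (- alpha)) &
    (forall tau y, 0 <= tau -> tau < m -> c <= y ->
       fine (P [set w | Y w < tau + y]) <= 1 - (m - tau) ^+ 2 / (v + m ^+ 2) *
         (1 - (1 - n%:R^-1 * (alpha^-1 * y `^ (- alpha))) ^+ n))].
Proof.
have eps0 := cutoff_gt0 alpha01 n0.
have [d1 [T1 [P1 [S [[mS S0] chS ES ES2 cS]]]]] := small_sum alpha01 n0 eps_c.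
have [d2 [T2 [P2 [L [[mL L0] chL PL tL cL]]]]] := large_sum alpha01 n0 eps_c.
pose Y (z : T1 * T2) := S z.1 + L z.2.
have mY : measurable_fun setT Y by exact: measurable_prod_add.
have fin2 (A : set T2) : measurable A -> P2 A \is a fin_num.
  by move=> mA; exact: fin_num_measure.
have fin1 (A : set T1) : measurable A -> P1 A \is a fin_num.
  by move=> mA; exact: fin_num_measure.
exists _, _, (P1 \x P2)%E, Y; split.
- by split => // z; rewrite addr_ge0.
- move=> t; rewrite charfunD// chS chL.
  have sA1 : `]eps, c]%classic `<=` `]eps, +oo[.
    by move=> x /=; rewrite !in_itv/= => /andP[->].
  have sA2 : `]c, +oo[%classic `<=` `]eps, +oo[.
    by move=> x /=; rewrite !in_itv/= !andbT; exact: lt_trans.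
  have s0 : `]eps, +oo[%classic `<=` `]0%R, +oo[.
    by move=> x /=; rewrite !in_itv/= !andbT; exact: lt_trans.
  have mA1 : measurable `]eps, c]%classic by exact: measurable_itv.
  have mA2 : measurable `]c, +oo[%classic by exact: measurable_itv.
  have [u1 u2] := levy_trig_le t alpha01 mA1 (subset_trans sA1 s0).
  have [u3 u4] := levy_trig_le t alpha01 mA2 (subset_trans sA2 s0).
  have [u5 u6] := levy_exp_le t alpha01.
  have [u7 u8] := levy_trig_split t alpha01 eps0 eps_c.
  apply: (charfun_powers_close n0 (levy_exp_re_le0 t alpha01) _ _
    (charfun_jump alpha01 n0 t mA1 sA1) (charfun_jump alpha01 n0 t mA2 sA2)
    u1 u2 u3 u4 u5 u6 u7 u8).
  + by apply: charfun_le1; exact: measurable_jump.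
  + by apply: charfun_le1; exact: measurable_jump.
- move=> M M0; have mA : measurable [set z | M < Y z] by exact: measurable_gt_set.
  rewrite -lee_fin fineK; last exact: fin_num_measure.
  (* Markov's inequality for [capped M]; the factor 2 counts the two sums. *)
  apply: (@le_trans _ _ (\int[(P1 \x P2)%E]_z (capped M (Y z))%:E)%E).
    apply: (@le_trans _ _
        (\int[(P1 \x P2)%E]_z (\1_[set z | (M < Y z)%R] z)%:E)%E).
      by rewrite integral_indic// setIT.
    apply: ge0_le_integral => //.
    + by apply/measurable_EFinP; exact: measurable_indic.
    + apply/measurable_EFinP; apply: measurableT_comp => //.
      exact: measurable_capped.
    + move=> z _; rewrite lee_fin indicE; have [|_] := boolP (z \in _).
        by rewrite inE/= => MY; rewrite capped_large// ltW.
      exact: capped_ge0.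
  apply: (le_trans (integral_prod_subadditive P1 P2 mS mL S0 L0
    (capped_subadditive M0))).
  by rewrite mulr2n mulrDl !mul1r EFinD leeD// ?cS ?cL.
- move=> a ma.
  have mSa : measurable [set w | a < S w] by exact: measurable_gt_set.
  have mL0 : measurable [set w | 0 < L w] by exact: measurable_gt_set.
  have h1 := chebyshev_upper mS S0 ES ES2 ma.
  rewrite addrK in h1.
  apply: (@le_trans _ _ (fine (P1 [set w | a < S w]) + fine (P2 [set w | 0 < L w]))).
    rewrite -lee_fin EFinD !fineK; [|exact: fin2|exact: fin1|]; last first.
      by apply: fin_num_measure; exact: measurable_gt_set.
    apply: (@le_trans _ _ ((P1 \x P2)%E
      (([set w | a < S w] `*` setT) `|` (setT `*` [set w | 0 < L w])))).
      apply: le_measure; rewrite ?inE.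
      + exact: measurable_gt_set.
      + by apply: measurableU; exact: measurableX.
      + move=> z /= aY; have [aS|Sa] := ltP a (S z.1); first by left.
        by right; split => //; move: aY; rewrite /Y; lra.
    apply: (le_trans (measureU2 _ _ _)) => /=; [exact: measurableX..|].
    rewrite !product_measure1E//=.
    have /= -> := probability_setT P1; have /= -> := probability_setT P2.
    by rewrite mule1 mul1e.
  rewrite lerD//.
  by rewrite -lee_fin fineK ?fin2.
- move=> tau y tau0 taum cy.
  have mSt : measurable [set w | tau <= S w] by exact: measurable_ge_set.
  have mLy : measurable [set w | L w < y] by exact: measurable_lt_set.
  have mLy' : measurable [set w | y <= L w] by exact: measurable_ge_set.
  have v0 : 0 < v + m ^+ 2.
    rewrite ltr_wpDl// ?exprn_gt0//; last exact: le_lt_trans taum.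
    rewrite mulr_ge0 ?powR_ge0// invr_ge0.
    by case/andP: alpha01 => _ a1; lra.
  have h1 := paley_zygmund mS S0 ES ES2 tau0 taum v0.
  have h2 : 1 - (1 - n%:R^-1 * (alpha^-1 * y `^ (- alpha))) ^+ n <=
      fine (P2 [set w | y <= L w]).
    have -> : [set w | y <= L w] = ~` [set w | L w < y].
      by apply/seteqP; split => w /=; rewrite leNgt => /negP.
    rewrite probability_setC// fineB ?fin2//= lerD2l lerN2.
    by rewrite -lee_fin fineK ?fin2// tL.
  apply: (@le_trans _ _ (1 - fine (P1 [set w | tau <= S w]) *
      fine (P2 [set w | y <= L w]))).
    rewrite -lee_fin fineK; last first.
      by apply: fin_num_measure; exact: measurable_lt_set.
    rewrite EFinB EFinM !fineK; [|exact: fin2|exact: fin1].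
    rewrite -product_measure1E// -probability_setC; last exact: measurableX.
    apply: le_measure; rewrite ?inE.
    + exact: measurable_lt_set.
    + by apply: measurableC; exact: measurableX.
    + by move=> z /= Yt [/= h3 h4]; move: Yt; rewrite /Y; lra.
  rewrite lerD2l lerN2.
  apply: (@le_trans _ _ ((m - tau) ^+ 2 / (v + m ^+ 2) * fine (P2 [set w | y <= L w]))).
    by rewrite ler_wpM2l// divr_ge0 ?sqr_ge0// ltW.
  by rewrite ler_wpM2r// fine_ge0.
Qed.

End approximants.

(** Induction from [(1 - q) (1 + (n + 1) q) <= 1 + n q]. It bounds the probability of no jump beyond
    [y] by [1 / (1 + n q)]. *)
Lemma onemX_bernoulli {R : realType} (q : R) n : 0 <= q <= 1 ->
  (1 - q) ^+ n * (1 + n%:R * q) <= 1.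
Proof.
move=> /andP[q0 q1]; elim: n => [|n IH]; first by rewrite expr0 mul0r addr0 mulr1.
apply: le_trans IH; rewrite exprSr -mulrA ler_wpM2l ?exprn_ge0 ?subr_ge0//.
have n0 : 0 <= n%:R :> R by [].
have := mulr_ge0 n0 (sqr_ge0 q); have := sqr_ge0 q.
by rewrite -natr1; nra.
Qed.

(* Young's inequality with exponents [1/p] and [1/(1-p)]. *)
Lemma powR_le_affine {R : realType} (p y : R) : 0 < p < 1 -> 0 <= y ->
  y `^ p <= p * y + 1.
Proof.
move=> /andP[p0 p1] y0.
have h := @conjugate_powR R (y `^ p) 1 p^-1 (1 - p)^-1 (powR_ge0 _ _) ler01.
have := h _ _ _; rewrite !invrK mulr1 powR1 -powRrM mulfV ?gt_eqF// powRr1// mul1r.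
rewrite !invr_gt0 subr_gt0 => /(_ p0 p1); rewrite subrKC => /(_ erefl).
lra.
Qed.

(** * Errors vanishing as n or M grows *)

Section limits.
Context {R : realType}.
Variable alpha : R.
Hypothesis alpha01 : 0 < alpha < 1.

Let a0 : 0 < alpha. Proof. by case/andP: alpha01. Qed.
Let a1 : alpha < 1. Proof. by case/andP: alpha01. Qed.

Lemma nat_large (x : R) : exists N, forall n, (N <= n)%N -> x <= n%:R.
Proof.
exists (Num.bound `|x|) => n Nn.
rewrite (le_trans (ler_norm _))// (le_trans (ltW (archi_boundP (normr_ge0 x))))//.
by rewrite ler_nat.
Qed.

Lemma cutoff_powR_small (p e : R) : 0 < p -> 0 < e ->
  exists N, forall n, (N <= n)%N -> cutoff alpha n `^ p <= e.
Proof.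
move=> p0 e0; have q0 : - (alpha^-1) * p < 0.
  by rewrite mulNr oppr_lt0 mulr_gt0// invr_gt0.
have [N hN] := nat_large (alpha^-1 * e `^ (- (alpha^-1) * p)^-1).
exists N => n /hN h; rewrite /cutoff -powRrM; apply: powR_small => //.
by rewrite -ler_pdivrMl.
Qed.

Lemma cutoff_small (e : R) : 0 < e ->
  exists N, forall n, (N <= n)%N -> cutoff alpha n < e.
Proof.
move=> e0; have e2 : 0 < e / 2 by rewrite divr_gt0.
have [N hN] := cutoff_powR_small ltr01 e2.
by exists N => n /hN; rewrite powRr1 ?powR_ge0//; lra.
Qed.

Lemma approx_error_small t e : 0 < e ->
  exists N, forall n, (N <= n)%N -> approx_error alpha n t <= e.
Proof.
move=> e0; have e2 : 0 < e / 2 by rewrite divr_gt0.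
pose C1 := 2 * ((`|t| + 2) * (1 - alpha)^-1).
pose C2 := 10 * ((`|t| + 2) * ((1 - alpha)^-1 + alpha^-1)) ^+ 2.
have C10 : 0 < C1.
  by rewrite !mulr_gt0// ?invr_gt0 ?subr_gt0//; have := normr_ge0 t; lra.
have b0 : 0 < 1 - alpha by rewrite subr_gt0.
have [N1 h1] := cutoff_powR_small b0 (divr_gt0 e2 C10).
have [N2 h2] := nat_large (C2 / (e / 2)).
exists (maxn (maxn N1 N2) 1) => n.
rewrite !geq_max -andbA => /and3P[/h1 k1 /h2 k2 n0].
have nR : 0 < n%:R :> R by rewrite ltr0n.
rewrite ler_pdivrMr// in k2; rewrite ler_pdivlMr// in k1.
have k2' : C2 / n%:R <= e / 2 by rewrite ler_pdivrMr// mulrC.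
by rewrite /approx_error -/C2; rewrite /C1 in k1; lra.
Qed.

Lemma capped_bound_small e : 0 < e ->
  exists2 M : R, 0 < M & forall M', M <= M' -> 2 * capped_bound alpha M' <= e.
Proof.
move=> e0; pose C := 2 * ((1 - alpha)^-1 + alpha^-1).
have C0 : 0 < C by rewrite mulr_gt0// addr_gt0// invr_gt0// subr_gt0.
have an : - alpha < 0 by rewrite oppr_lt0.
exists ((e / C) `^ (- alpha)^-1); first by rewrite powR_gt0 ?divr_gt0.
move=> M' /(powR_small an (divr_gt0 e0 C0)); rewrite ler_pdivlMr// => h.
by rewrite /capped_bound mulrA -/C mulrC.
Qed.

End limits.

(** * The two tail bounds for the stable law *)

Lemma stable_upper_tail (R : realType) (d : measure_display) (T : measurableType d)
  (P : probability T R) (X : T -> R) (alpha y : R) : measurable_fun setT X ->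
  0 < alpha < 1 ->
  (forall t, charfun P X t = cexp (levy_exp_re alpha t) (levy_exp_im alpha t)) ->
  1 <= y ->
  fine (P [set w | 1 / (1 - alpha) + 3 * y < X w]) <= 2 / (alpha * y `^ alpha).
Proof.
move=> mX alpha01 chX y1; case/andP: (alpha01) => a0 a1.
have y0 : 0 < y by exact: lt_le_trans y1.
have b0 : 0 < 1 - alpha by rewrite subr_gt0.
apply: (@weak_limit_upper _ _ _ P X mX (fun n t => approx_error alpha n t)
  (approx_error_small alpha01)).
  by rewrite addr_ge0// ?divr_ge0// ?mulr_ge0// ltW.
move=> e e0; have [N hN] := cutoff_small alpha01 y0.
exists (maxn N 1) => n; rewrite geq_max => /andP[/hN ny n0].
have [d' [T' [P' [Y [[mY Y0] ch _ up _]]]]] := stable_approx alpha01 n0 ny.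
exists d', T', P', Y; split => //; first by move=> t; rewrite chX.
set a := 1 / (1 - alpha) + 3 * y.
(* Young's inequality bounds the mean of the small jumps by [y + 1 / (1 - alpha)]; this is where the
   shift [1 / (1 - alpha)] comes from. *)
have dev : 2 * y <= a - small_mean alpha y n.
  have h1 : y `^ (1 - alpha) <= (1 - alpha) * y + 1.
    by apply: powR_le_affine; [rewrite b0 gtrBl|exact: ltW].
  have h2 : small_mean alpha y n <= (1 - alpha)^-1 * ((1 - alpha) * y + 1).
    rewrite /small_mean ler_wpM2l ?invr_ge0 ?(ltW b0)//.
    by rewrite (le_trans _ h1)// gerBl powR_ge0.
  rewrite mulrDr mulrA mulVf ?gt_eqF// mul1r mulr1 in h2.
  by rewrite /a div1r; lra.
have ma : small_mean alpha y n < a by lra.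
apply: (le_trans (up _ ma)).
have yna : y `^ (- alpha) = (y `^ alpha)^-1 by rewrite powRN.
have p0 : 0 < y `^ (- alpha) by rewrite powR_gt0.
have -> : 2 / (alpha * y `^ alpha) = 2 * (alpha^-1 * y `^ (- alpha)).
  by rewrite yna invfM.
(* The other half of the bound is [P(L > 0)]. Here a deviation of [y] is enough:
   [y^(2 - alpha) / y^2 = y^(-alpha)], and [alpha <= 2 - alpha]. *)
suff : small_var alpha y / (a - small_mean alpha y n) ^+ 2 <=
    alpha^-1 * y `^ (- alpha) by lra.
rewrite ler_pdivrMr; last by rewrite exprn_gt0//; lra.
have y2 : y `^ (2 - alpha) = y ^+ 2 * y `^ (- alpha).
  rewrite powRD; first by rewrite powR_mulrn// ltW.
  by rewrite (gt_eqF y0) implybT.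
have h4 : y ^+ 2 <= (a - small_mean alpha y n) ^+ 2.
  by rewrite ler_pXn2r// ?nnegrE; lra.
have h5 : (2 - alpha)^-1 <= alpha^-1 by rewrite lef_pV2 ?posrE//; lra.
have h6 : 0 <= (2 - alpha)^-1 by rewrite invr_ge0; lra.
rewrite /small_var y2 mulrA [leRHS]mulrAC ler_wpM2r ?(ltW p0)//.
by rewrite ler_pM ?sqr_ge0.
Qed.

Lemma stable_lower_tail (R : realType) (d : measure_display) (T : measurableType d)
  (P : probability T R) (X : T -> R) (alpha y theta : R) : measurable_fun setT X ->
  0 < alpha < 1 ->
  (forall t, charfun P X t = cexp (levy_exp_re alpha t) (levy_exp_im alpha t)) ->
  1 <= y -> 0 < theta < 1 ->
  fine (P [set w | X w < theta / (1 - alpha) + y]) <=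
    1 - 2 / 3 * (1 - theta) ^+ 2 * (1 / (1 + alpha * y `^ alpha)).
Proof.
move=> mX alpha01 chX y1 /andP[t0 t1]; case/andP: (alpha01) => a0 a1.
have y0 : 0 < y by exact: lt_le_trans y1.
have b0 : 0 < 1 - alpha by rewrite subr_gt0.
apply: (@weak_limit_lower _ _ _ P X mX (fun n t => approx_error alpha n t)
  (approx_error_small alpha01) _ _ _
  (capped_bound_small alpha01)).
move=> e e0.
(* [eta] is the relative defect of the mean due to the cutoff: [e / 2] controls the loss,
   [(1 - theta) / 2] keeps the threshold below the mean. *)
have eta0 : 0 < Num.min (e / 2) ((1 - theta) / 2).
  by rewrite lt_min !divr_gt0// subr_gt0.
pose lam := alpha^-1 * y `^ (- alpha).
have lam0 : 0 < lam by rewrite mulr_gt0 ?invr_gt0 ?powR_gt0.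
have [N1 h1] := cutoff_small alpha01 ltr01.
have [N2 h2] := cutoff_powR_small alpha01 b0 eta0.
have [N3 h3] := nat_large lam.
(* [N3] ensures [lam <= n], so that [q = lam / n] is at most 1. *)
exists (maxn (maxn N1 N2) (maxn N3 1)) => n.
rewrite !geq_max => /andP[/andP[/h1 ny /h2 eta_le] /andP[/h3 lamn n0]].
have [d' [T' [P' [Y [[mY Y0] ch tight _ low]]]]] := stable_approx alpha01 n0 ny.
exists d', T', P', Y; split => //; first by move=> t; rewrite chX.
have nR : 0 < n%:R :> R by rewrite ltr0n.
set eta := cutoff alpha n `^ (1 - alpha) in eta_le.
have eta_ge0 : 0 <= eta by exact: powR_ge0.
move: eta_le; rewrite le_min => /andP[eta1 eta2].
pose M := (1 - alpha)^-1.
have M1 : 1 < M by rewrite invf_gt1// gtrBl.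
have mE : small_mean alpha 1 n = M * (1 - eta) by rewrite /small_mean powR1.
have vE : small_var alpha 1 = (2 - alpha)^-1 by rewrite /small_var powR1 mulr1.
have tm : theta / (1 - alpha) < small_mean alpha 1 n.
  by rewrite mE mulrC ltr_pM2l ?invr_gt0//; lra.
have tau0 : 0 <= theta / (1 - alpha) by rewrite divr_ge0// ltW.
apply: (le_trans (low _ _ tau0 tm y1)).
rewrite -addrA lerD2l -lerN2 opprK opprD opprK mE vE -/lam.
set q := n%:R^-1 * lam.
have q01 : 0 <= q <= 1.
  apply/andP; split; first by rewrite mulr_ge0 ?invr_ge0 ?(ltW nR) ?(ltW lam0).
  by rewrite /q mulrC ler_pdivrMr// mul1r.
have nq : n%:R * q = lam by rewrite mulVKf// gt_eqF.
pose rho := 1 / (1 + alpha * y `^ alpha).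
have ya : 0 < y `^ alpha by rewrite powR_gt0.
have aya : 0 < alpha * y `^ alpha by rewrite mulr_gt0.
have rho0 : 0 <= rho by rewrite divr_ge0//; lra.
have rho1 : rho <= 1 by rewrite ler_pdivrMr ?mul1r//; lra.
(* [rho = lam / (1 + lam)], the form delivered by the Bernoulli-type inequality. *)
have rhoE : rho = 1 - (1 + lam)^-1.
  rewrite /rho /lam powRN; field.
  by rewrite !gt_eqF//; lra.
have big : rho <= 1 - (1 - q) ^+ n.
  rewrite rhoE lerD2l lerN2 -[leRHS]div1r ler_pdivlMr; last lra.
  by rewrite -nq; exact: onemX_bernoulli.
have var : (2 - alpha)^-1 + (M * (1 - eta)) ^+ 2 <= 3 / 2 * M ^+ 2.
  have k1 : (2 - alpha)^-1 <= M ^+ 2 / 2.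
    have p1 : 2 - alpha \is Num.pos by rewrite posrE; lra.
    have p2 : (1 - alpha) ^+ 2 * 2 \is Num.pos.
      by rewrite posrE mulr_gt0// exprn_gt0.
    by rewrite /M exprVn -invfM lef_pV2//; nra.
  have k2 : (M * (1 - eta)) ^+ 2 <= M ^+ 2.
    by rewrite exprMn ler_piMr ?sqr_ge0// exprn_ile1//; lra.
  by lra.
have vpos : 0 < (2 - alpha)^-1 + (M * (1 - eta)) ^+ 2.
  by rewrite ltr_wpDr ?sqr_ge0// invr_gt0; lra.
(* The cutoff costs at most [(2/3) * 2 * eta * (1 - theta)], which is below [e] since
   [eta <= e / 2]. *)
have frac : 2 / 3 * (1 - theta) ^+ 2 - e <=
    (M * (1 - eta) - theta / (1 - alpha)) ^+ 2 /
    ((2 - alpha)^-1 + (M * (1 - eta)) ^+ 2).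
  have -> : M * (1 - eta) - theta / (1 - alpha) = M * (1 - theta - eta).
    by rewrite -/M; ring.
  apply: (@le_trans _ _ (2 / 3 * (1 - theta - eta) ^+ 2)).
    have : 0 <= eta ^+ 2 by exact: sqr_ge0.
    have : eta * (1 - theta) <= eta by rewrite ler_piMr//; lra.
    lra.
  rewrite ler_pdivlMr// exprMn.
  have := ler_wpM2l (sqr_ge0 (1 - theta - eta)) var; lra.
rewrite -/rho.
have F0 : 0 <= (M * (1 - eta) - theta / (1 - alpha)) ^+ 2 /
    ((2 - alpha)^-1 + (M * (1 - eta)) ^+ 2).
  by rewrite divr_ge0 ?sqr_ge0// ltW.
move: frac F0.
set F := (M * (1 - eta) - theta / (1 - alpha)) ^+ 2 / _ => frac F0.
have s1 : F * rho <= F * (1 - (1 - q) ^+ n) by exact: ler_wpM2l.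
have s2 : (2 / 3 * (1 - theta) ^+ 2 - e) * rho <= F * rho by exact: ler_wpM2r.
have s3 : e * rho <= e by rewrite ler_piMr// ltW.
lra.
Qed.

Theorem theorem6 (R : realType) (d : measure_display) (T : measurableType d)
  (P : probability T R) (X : {RV P >-> R}) (alpha : R) :
  0 < alpha < 1 ->
  has_stable_charfun P X alpha ->
  (forall y : R, (1 / alpha) `^ (1 / alpha) <= y ->
     (P [set w | (1 / (1 - alpha) + 3 * y < X w)%R] <= (2 / (alpha * y `^ alpha))%:E)%E) /\
  (forall y theta : R, 1 <= y -> 0 < theta < 1 ->
     ((2 / 3 * (1 - theta) ^+ 2 * (1 / (1 + alpha * y `^ alpha)))%:E
        <= P [set w | (theta / (1 - alpha) + y <= X w)%R])%E).
Proof.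
move=> alpha01 hX; case/andP: (alpha01) => a0 a1.
have mX : measurable_fun setT X by exact: measurable_funP.
have chX t : charfun P X t = cexp (levy_exp_re alpha t) (levy_exp_im alpha t).
  by have [hc hs] := hX t; rewrite /charfun /Rintegral hc hs.
split=> [y hy|y theta y1 th].
  (* The threshold is a nonnegative power of [1 / alpha >= 1]. *)
  have y1 : 1 <= y.
    rewrite (le_trans _ hy)// -[leLHS](powRr0 (1 / alpha)) ler_powR//.
      by rewrite ler_pdivlMr// mul1r ltW.
    by rewrite divr_ge0// ltW.
  rewrite -[leLHS]fineK; last first.
    by apply: fin_num_measure; exact: measurable_gt_set.
  rewrite lee_fin; exact: stable_upper_tail.
have h := @stable_lower_tail R d T P X alpha y theta mX alpha01 chX y1 th.
have mA : measurable [set w | X w < theta / (1 - alpha) + y].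
  exact: measurable_lt_set.
have -> : [set w | theta / (1 - alpha) + y <= X w] =
    ~` [set w | X w < theta / (1 - alpha) + y].
  by apply/seteqP; split => w /=; rewrite leNgt => /negP.
rewrite probability_setC// -[X in (1 - X)%E]fineK; last exact: fin_num_measure.
by rewrite -EFinB lee_fin lerBrDl -lerBrDr.
Qed.
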